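(* Let $F(X)=X^5+a_4X^4+a_3X^3+a_2X^2+a_1X+a_0$ with $a_0,\dots,a_4\in\mathbb{Z}$ be such that $Y^2=F(X)$ defines a hyperelliptic curve $C$ of genus $2$ over $\mathbb{Q}$. Let $P=(x_P,y_P)$ with $x_P,y_P\in\mathbb{Z}$ be an integral point on $C\setminus\{\infty\}$, let $D_P=[P]-[\infty]\in \mathrm{Jac}(C)(\mathbb{Q})$, and let $c_n=\psi_n(x_P)\in\mathbb{Z}$ for $n\in\mathbb{Z}$, where $\psi_n(X)\in\mathbb{Z}[X]$ is the $n$-th Cantor division polynomial of $C$. Assume that $c_3c_4c_5c_6c_7(c_4^3-c_3^3c_5)\neq 0$. Let $p$ be an odd prime which divides neither $\mathrm{disc}(F)$ nor $c_3c_4c_5c_6c_7(c_4^3-c_3^3c_5)$. Let $r=\mathrm{ord}_p(D_P)$ be the order of the reduction $\overline{D_P}\in\mathrm{Jac}(C)(\mathbb{F}_p)$ of $D_P$ modulo $p$, and let $\alpha_p,\beta_p\in\mathbb{F}_p$ be the elements satisfying $$\alpha_p\equiv \frac{c_{r+3}}{c_3c_{r+2}}\pmod p,\qquad \beta_p\equiv\frac{c_3^2c_{r+2}^3}{c_{r+3}^2}\pmod p,$$ where $c_{r+2},c_{r+3}\not\equiv0\pmod p$. Let $d$ be the least positive integer such that $\alpha_p^d\equiv\beta_p^{d^2}\equiv1\pmod p$. Then the period $\mathrm{Per}_p(\boldsymbol{c})$ of the reduction modulo $p$ of the sequence $\boldsymbol{c}=\{c_n\}_{n\in\mathbb{Z}}$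 satisfies $$\mathrm{Per}_p(\boldsymbol{c})=d\,\mathrm{ord}_p(D_P).$$
   Context: $C$ is the smooth projective curve with affine equation $Y^2=F(X)$ ($\mathrm{disc}(F)\neq0$), with unique point at infinity $\infty$, and $\mathrm{Jac}(C)$ is its Jacobian. For an odd prime $p\nmid \mathrm{disc}(F)$, $C$ and $\mathrm{Jac}(C)$ have good reduction at $p$; $\mathrm{Jac}(C)(\mathbb{F}_p)$ denotes the $\mathbb{F}_p$-points of the Jacobian of the reduced curve, and $\overline{D_P}=[\overline P]-[\infty]$ with $\overline P$ the reduction of $P$. Cantor's division polynomials: let $S(z)=-\sqrt{F(X-z)}$ be the power series in $z$ with $S(z)^2=F(X-z)$ and constant term $-Y$, where $Y^2=F(X)$. For $j\ge1$ its $z^j$-coefficient has the form $P_j(X)\,(2Y)^{1-2j}$ with $P_j(X)\in\mathbb{Z}[a_0,\dots,a_4][X]$. Put $\psi_0=\psi_1=0$ and, for every integer $N\ge0$, $\psi_{2N+2}(X)=\det\big(P_{3+i+j}(X)\big)_{0\le i,j\le N-1}$ and $\psi_{2N+3}(X)=4F(X)\det\big(P_{4+i+j}(X)\big)_{0\le i,j\le N-1}$ (empty determinant $=1$), and $\psi_{-n}=-\psi_n$. In particular $\psi_2=1$, $\psi_3=4F$. A sequence $\{b_n\}_{n\in\mathbb{Z}}$ is periodic if there is $s\ge1$ with $b_{n+s}=b_n$ for all $n\in\mathbb{Z}$; its period is the least such $s$. Under the stated hypotheses the reduction modulo $p$ of $\boldsymbol c$ is periodic, and $c_{r+2},c_{r+3}\not\equiv0\pmod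 p$ always holds (so $\alpha_p,\beta_p$ are well defined); this is not an additional hypothesis. *)

(* Defs.v *)
From HB Require Import structures.
From mathcomp Require Import all_boot all_order all_algebra all_field.
From mathcomp Require Import ring zify freeg.

Set Implicit Arguments.
Unset Strict Implicit.
Unset Printing Implicit Defensive.

Import Order.TTheory GRing.Theory Num.Theory.
Local Open Scope ring_scope.

Definition least_pos (Q : nat -> Prop) (n : nat) : Prop :=
  [/\ (0 < n)%N, Q n & forall m : nat, (0 < m)%N -> Q m -> (n <= m)%N].

Definition is_period (T : Type) (b : int -> T) : nat -> Prop :=
  least_pos (fun s => forall n : int, b (n + s%:Z) = b n).

(* The discriminant of a monic polynomial. *)
Definition discr (R : comNzRingType) (F : {poly R}) : R :=
  (-1) ^+ 'C((size F).-1, 2) * resultant F F^`().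

(** * Cantor's division polynomials *)

(* F(X - z) in R[X][z]: the outer variable is z, the inner one is X. *)
Definition shift_poly (R : comNzRingType) (F : {poly R}) : {poly {poly R}} :=
  F^:P \Po ('X%:P - 'X).

(* [:: P_0; ...; P_n], where P_0 = 0 is a dummy entry. Substituting
   s_0 = - Y and s_j = P_j (2Y)^(1 - 2j) for j >= 1 in the z^j-coefficient of
   S(z)^2 = F(X - z) and multiplying by (2Y)^(2j - 2) gives
     P_j = \sum_(0 < i < j) P_i P_(j-i) - (4F)^(j-1) [z^j] F(X - z);
   cantor_PP below checks that this is the expansion of S. *)
Fixpoint cantor_P_seq (R : comNzRingType) (F : {poly R}) (n : nat) :
    seq {poly R} :=
  if n is m.+1 then
    let s := cantor_P_seq F m in
    rcons s (\sum_(1 <= i < n) s`_i * s`_(n - i)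
             - (4 *: F) ^+ m * (shift_poly F)`_n)
  else [:: 0].

Definition cantor_P (R : comNzRingType) (F : {poly R}) (j : nat) : {poly R} :=
  (cantor_P_seq F j)`_j.

Definition psi_nat (R : comNzRingType) (F : {poly R}) (n : nat) : {poly R} :=
  if n is m.+2 then
    let N := m./2 in
    if odd m then
      4 *: F * \det (\matrix_(i < N, j < N) cantor_P F (4 + i + j))
    else \det (\matrix_(i < N, j < N) cantor_P F (3 + i + j))
  else 0.

Definition psi (R : comNzRingType) (F : {poly R}) (n : int) : {poly R} :=
  match n with Posz m => psi_nat F m | Negz m => - psi_nat F m.+1 end.

Section CantorP.
Variables (R : comNzRingType) (F : {poly R}).

Lemma size_cantor_P_seq n : size (cantor_P_seq F n) = n.+1.
Proof. by elim: n => //= n IHn; rewrite size_rcons IHn. Qed.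

Lemma nth_cantor_P_seq n j : (j <= n)%N ->
  (cantor_P_seq F n)`_j = cantor_P F j.
Proof.
elim: n => [|n IHn]; first by rewrite leqn0 => /eqP->.
rewrite leq_eqVlt => /predU1P[->//|le_jn].
by rewrite /= nth_rcons size_cantor_P_seq le_jn IHn.
Qed.

Lemma cantor_P_rec n : cantor_P F n.+1 =
  \sum_(1 <= i < n.+1) cantor_P F i * cantor_P F (n.+1 - i)
  - (4 *: F) ^+ n * (shift_poly F)`_n.+1.
Proof.
rewrite {1}/cantor_P /= nth_rcons size_cantor_P_seq ltnn eqxx.
congr (_ - _); apply: eq_big_nat => i /andP[i_gt0 lt_in].
by rewrite !nth_cantor_P_seq //; case: i i_gt0 {lt_in} => // i _;
  rewrite subSS leq_subr.
Qed.

End CantorP.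

(* S(z) = \sum_j s_j z^j is a square root of F(x - z) with constant term - y
   exactly when s_j = P_j(x) (2y)^(1 - 2j) for all j >= 1. *)
Lemma cantor_PP (L : fieldType) (F : {poly L}) (x y : L) (s : nat -> L) :
    (2 : L) != 0 -> y != 0 -> y ^+ 2 = F.[x] -> s 0%N = - y ->
  (forall j, \sum_(i < j.+1) s i * s (j - i)%N = ((shift_poly F)`_j).[x]) <->
  (forall j, s j.+1 = (cantor_P F j.+1).[x] * (2 * y) / (2 * y) ^+ (2 * j.+1)).
Proof.
move=> nz2 nzy yF s0; set w := 2 * y.
have nzw : w != 0 by rewrite mulf_neq0.
have w2 : w ^+ 2 = 4 * F.[x] by rewrite exprMn yF -natrX.
pose t j := (cantor_P F j).[x] * w / w ^+ (2 * j).
have shift0 : ((shift_poly F)`_0).[x] = F.[x].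
  rewrite -horner_coef0 horner_comp !hornerE /= subr0.
  by rewrite -/(F \Po 'X) comp_polyXr.
have step n : (forall i, (i < n)%N -> s i.+1 = t i.+1) ->
  \sum_(i < n.+2) s i * s (n.+1 - i)%N =
  ((shift_poly F)`_n.+1).[x] + w * (t n.+1 - s n.+1).
  move=> st; pose Q := (\sum_(1 <= i < n.+1)
                          cantor_P F i * cantor_P F (n.+1 - i)).[x].
  have wn : w ^+ (2 * n) != 0 by rewrite expf_neq0.
  have sQ : \sum_(1 <= i < n.+1) s i * s (n.+1 - i)%N = Q / w ^+ (2 * n).
    rewrite /Q horner_sum mulr_suml; apply: eq_big_nat => i /andP[i_gt0 lt_in].
    have [k def_i]: exists k, i = k.+1 by case: i i_gt0 {lt_in} => // k; exists k.
    have [l def_l]: exists l, (n.+1 - i)%N = l.+1 by exists (n - i)%N; rewrite subSn.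
    have def_n: n = (k + l).+1 by move: def_l lt_in; rewrite def_i; lia.
    rewrite def_l def_i !st; [|lia|lia].
    rewrite hornerM /t def_n.
    have -> : (2 * (k + l).+1 = 2 * k + 2 * l + 2)%N by lia.
    have -> : (2 * k.+1 = 2 * k + 2)%N by lia.
    have -> : (2 * l.+1 = 2 * l + 2)%N by lia.
    rewrite !exprD; field.
    by rewrite nzw !expf_neq0.
  have tP : w * t n.+1 = (cantor_P F n.+1).[x] / w ^+ (2 * n).
    by rewrite /t mulnS addnC exprD; field; rewrite nzw wn.
  have <- := big_mkord xpredT (fun i => s i * s (n.+1 - i)%N).
  rewrite big_nat_recr //= big_ltn // sQ mulrBr tP cantor_P_rec subn0 subnn s0.
  rewrite hornerD hornerN hornerM horner_exp hornerZ -/Q -w2 -exprM.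
  by rewrite /w; field; rewrite -/w wn.
split=> [conv j | st [|j]].
- elim/ltn_ind: j => j IHj.
  have /eqP := step j IHj; rewrite conv -subr_eq0 opprD addrA subrr sub0r oppr_eq0.
  by rewrite mulf_eq0 (negPf nzw) subr_eq0 => /eqP <-.
- by rewrite big_ord1 /= s0 mulrNN -expr2 yF shift0.
- by rewrite step // /t st subrr mulr0 addr0.
Qed.

(** * The curve Y^2 = f(X) and its divisor class group *)

Definition affine_pt (R : comNzRingType) (f : {poly R}) :=
  {q : R * R | q.2 ^+ 2 == f.[q.1]}.

Lemma affine_map_subproof (R S : comNzRingType) (h : {rmorphism R -> S})
    (f : {poly R}) (Q : affine_pt f) :
  h (val Q).2 ^+ 2 == (map_poly h f).[h (val Q).1].
Proof. by rewrite horner_map -rmorphXn /= (eqP (valP Q)). Qed.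

Definition affine_map (R S : comNzRingType) (h : {rmorphism R -> S})
    (f : {poly R}) (Q : affine_pt f) : affine_pt (map_poly h f) :=
  exist _ (h (val Q).1, h (val Q).2) (affine_map_subproof h Q).

Definition red_mod (p : nat) : {rmorphism int -> 'F_p} := intmul 1.

Section Curve.
Variables (K : closedFieldType) (f : {poly K}).

(* The coordinate ring K[X][Y] / (Y^2 - f(X)) of the affine curve. An element
   g is represented by a(X) + b(X) Y with a = g`_0 and b = g`_1. *)
Definition coord_ring : comNzRingType := {poly %/ ('X^2 - f%:P)}.

Definition coord_const (c : K) : coord_ring := in_qpoly _ c%:P%:P.
Definition coord_X : coord_ring := in_qpoly _ 'X%:P.
Definition coord_Y : coord_ring := in_qpoly _ 'X.

(* Points of the smooth projective curve for f of odd degree; None is the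
   unique point at infinity. *)
Definition curve_pt := option (affine_pt f).

Definition divisor := {freeg curve_pt / int}.

(* g lies in the n-th power of the maximal ideal (X - x_Q, Y - y_Q). *)
Definition in_max_ideal_pow (Q : affine_pt f) (n : nat) (g : coord_ring) :=
  exists u : 'I_n.+1 -> coord_ring,
    g = \sum_(i < n.+1) u i * (coord_X - coord_const (val Q).1) ^+ i
                            * (coord_Y - coord_const (val Q).2) ^+ (n - i).

Definition vanishing_order (Q : affine_pt f) (g : coord_ring) (n : nat) :=
  in_max_ideal_pow Q n g /\ ~ in_max_ideal_pow Q n.+1 g.

(* At infinity X has a pole of order 2 and Y one of order deg f;
   as deg f is odd, the poles of a(X) and b(X) Y have different orders. *)
Definition pole_order (g : coord_ring) : nat :=
  let a := (g : {poly {poly K}})`_0 in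
  let b := (g : {poly {poly K}})`_1 in
  maxn (2 * (size a).-1)%N
       (if b == 0 then 0%N else (2 * (size b).-1 + (size f).-1)%N).

Definition is_div (g : coord_ring) (D : divisor) : Prop :=
  (forall Q : affine_pt f,
     exists2 n : nat, vanishing_order Q g n & coeff (Some Q) D = n%:Z)
  /\ coeff None D = - (pole_order g)%:Z.

(* Every nonzero rational function is a quotient g / h of nonzero elements of
   the coordinate ring. *)
Definition principal (D : divisor) : Prop :=
  exists g h : coord_ring, exists Dg Dh : divisor,
    [/\ g != 0, h != 0, is_div g Dg, is_div h Dh & D = Dg - Dh].

(* The order of the class of a degree 0 divisor D in Div^0 / Prin, which is
   the group of K-points of the Jacobian. When K is an algebraic closure of
   F_p and D is defined over F_p, this is also its order in the subgroup of
   F_p-points. *)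
Definition class_order (D : divisor) : nat -> Prop :=
  least_pos (fun r => principal (D *+ r)).

Definition point_divisor (Q : affine_pt f) : divisor :=
  << Some Q >> - << None >>.

End Curve.

(* Main.v *)
Require Import Defs.
From HB Require Import structures.
From mathcomp Require Import all_boot all_order all_algebra all_field.
From mathcomp Require Import all_fingroup ring zify freeg.

Set Implicit Arguments.
Unset Strict Implicit.
Unset Printing Implicit Defensive.

Import Order.TTheory GRing.Theory Num.Theory.
Local Open Scope ring_scope.

(** Let P = (x, y) be the reduced point on the curve Y^2 = f(X) over K. For
    n >= 2 the functions with a pole of order at most n + 1 at infinity, and no
    other pole, form a space with basis 1, X, X^2, Y, X^3, X Y, .. of dimension n.
    Let tau n be the determinant of the map that sends such a function to its
    Taylor expansion at P up to the order n. The rows of the powers of X are unit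
    vectors, and what remains is a Hankel matrix of Taylor coefficients of Y. This
    is Cantor's determinant, so the value of the n-th division polynomial at x is
    (2 y)^(C(n, 2) - 1) tau n ([psi_tau]). It vanishes exactly when some nonzero
    function with a pole of order at most n + 1 has a zero of order n at P.

    That r (P - infinity) is principal means that there is a function g whose
    divisor is r P - r infinity ([torsion_at_of_principal] and
    [principal_of_torsion_at] translate between the two). Let u be the leading
    Taylor coefficient of g at P.

    Multiplication by g embeds the space for n into the space for n + r. The
    image consists of the functions that vanish to the order r at P, and a
    complement of dimension r is spanned by basis functions that do not depend on
    n. Hence the matrix for n + r is block triangular in a suitable basis: one
    block is a fixed r x r matrix with determinant kappa, the other is the matrix
    for n times an upper triangular matrix with u on the diagonal. This gives
    tau (n + r) = - kappa u^n tau n for n >= 2 ([tau_shift]).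

    The residues at P of a b dX / (Y g) define a perfect pairing on Taylor
    expansions up to the order r, and by the residue theorem the spaces for m and
    for r - m are orthogonal to each other. So the matrix for m is, up to scalars,
    a complementary minor of the matrix for r - m, which gives
    kappa tau (r - m) = (2 y u)^(r - m) tau m ([tau_reflect]).

    Together with the oddness of the sequence c these two formulas show that
    c (n + r) = A^n B c n for all integers n, with A^r = B^2
    ([c_quasi_periodic]). Evaluation at n = 2 and n = 3 identifies A and B with
    alpha and beta. Iteration gives c (n + k r) = A^(k n) B^(k^2) c n, so k r is a
    period exactly when alpha^k = beta^(k^2) = 1, again because c 2 and c 3 are
    not 0.

    It remains to see that r divides every period t. As c (t - 1) = c (- 1) = 0
    and c (t + 1) = c 1 = 0, there are functions with poles of order at most t and
    t + 2 and zeros of order at least t - 1 and t + 1 at P. The product of the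
    second and the conjugate of the first must be a multiple of (X - x)^(t + 1),
    which forces the first to have the divisor t P - t infinity
    ([torsion_of_tau_eq0]). *)

(** * Determinants of the low coefficients of polynomials *)

Section CoefDet.
Variable K : fieldType.
Implicit Types (R : nat -> {poly K}) (p u : {poly K}) (l pre post : seq {poly K}).

Definition coef_det (n : nat) R : K := \det (\matrix_(i < n, j < n) (R i)`_j).

Lemma eq_coef_det n R R' :
  (forall i j, (i < n)%N -> (j < n)%N -> (R i)`_j = (R' i)`_j) ->
  coef_det n R = coef_det n R'.
Proof. by move=> eqR; congr (\det _); apply/matrixP=> i j; rewrite !mxE eqR. Qed.

Lemma coef_det_unitriangular n (B : nat -> nat -> K) R R' :
  (forall i, (i < n)%N -> B i i = 1) ->
  (forall i, (i < n)%N -> R' i = \sum_(j < i.+1) B i j *: R j) ->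
  coef_det n R' = coef_det n R.
Proof.
move=> B1 R'E.
pose M := \matrix_(i < n, j < n) (if (j <= i)%N then B i j else 0).
have detM : \det M = 1.
  rewrite det_trig; last first.
    by apply/is_trig_mxP => i j lt_ij; rewrite mxE leqNgt lt_ij.
  by rewrite big1 // => i _; rewrite mxE leqnn B1.
rewrite -[RHS]mul1r -detM /coef_det -det_mulmx; congr (\det _).
apply/matrixP => i j; rewrite !mxE R'E // coef_sum.
rewrite (big_ord_widen_cond n xpredT (fun k => (B i k *: R k)`_j)) //.
rewrite big_mkcond /=; apply: eq_bigr => k _; rewrite !mxE ltnS.
by case: ifP => _; rewrite ?mul0r // coefZ.
Qed.

Lemma coef_det_mul n u R : coef_det n (fun i => u * R i) = u`_0 ^+ n * coef_det n R.
Proof.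
pose U := \matrix_(i < n, j < n) (if (i <= j)%N then u`_(j - i) else 0).
have detU : \det U = u`_0 ^+ n.
  rewrite -det_tr det_trig; last first.
    by apply/is_trig_mxP => i j lt_ij; rewrite !mxE leqNgt lt_ij.
  under eq_bigr => i _ do rewrite !mxE leqnn subnn.
  by rewrite prodr_const card_ord.
rewrite mulrC -detU /coef_det -det_mulmx; congr (\det _).
apply/matrixP => i j; rewrite !mxE mulrC coefM.
rewrite (big_ord_widen_cond n xpredT (fun k => (R i)`_k * u`_(j - k))) //.
rewrite big_mkcond /=; apply: eq_bigr => k _; rewrite !mxE ltnS.
by case: ifP => _; rewrite ?mulr0.
Qed.

Lemma coef_det_lblock k n R :
  (forall i j, (i < k)%N -> (k <= j < k + n)%N -> (R i)`_j = 0) ->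
  coef_det (k + n) R =
  coef_det k R * \det (\matrix_(i < n, j < n) (R (k + i)%N)`_(k + j)).
Proof.
move=> R0; rewrite /coef_det -[X in \det X = _]submxK.
set M := \matrix_(_, _) _.
have -> : ursubmx M = 0.
  apply/matrixP => i j; rewrite !mxE /= R0 //.
  by rewrite leq_addr ltn_add2l ltn_ord.
rewrite det_lblock; congr (_ * _); congr (\det _);
  by apply/matrixP => i j; rewrite !mxE.
Qed.

Lemma coef_det_ublock k n R :
  (forall i j, (k <= i < k + n)%N -> (j < k)%N -> (R i)`_j = 0) ->
  coef_det (k + n) R =
  coef_det k R * \det (\matrix_(i < n, j < n) (R (k + i)%N)`_(k + j)).
Proof.
move=> R0; rewrite /coef_det -[X in \det X = _]submxK.
set M := \matrix_(_, _) _.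
have -> : dlsubmx M = 0.
  apply/matrixP => i j; rewrite !mxE /= R0 //.
  by rewrite leq_addr ltn_add2l ltn_ord.
rewrite det_ublock; congr (_ * _); congr (\det _);
  by apply/matrixP => i j; rewrite !mxE.
Qed.

Lemma coef_det_swap n k R R' : (k.+1 < n)%N ->
  R' k = R k.+1 -> R' k.+1 = R k ->
  (forall i, i != k -> i != k.+1 -> R' i = R i) ->
  coef_det n R' = - coef_det n R.
Proof.
move=> lt_kn R'k R'k1 R'E; have lt_k : (k < n)%N by apply: ltnW.
pose a := Ordinal lt_k; pose b := Ordinal lt_kn.
have ab : a != b by rewrite -val_eqE /= neq_ltn ltnSn.
rewrite /coef_det -[RHS]mulN1r.
have <- : \det (perm_mx (tperm a b)) = -1 :> K by rewrite det_perm odd_tperm ab.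
rewrite -det_mulmx -row_permE; congr (\det _); apply/matrixP => i j.
rewrite !mxE; case: tpermP => [->|->|/eqP ia /eqP ib]; rewrite ?R'k ?R'k1 //.
by rewrite R'E.
Qed.

(** Rows k and k + 1 are interleaved with the two rows that follow them. The gaps
    1 and 3 among the pole orders at infinity cause this reordering; it is an odd
    permutation. *)
Definition shuffle k i : nat :=
  if i == k then k.+2 else if i == k.+1 then k
  else if i == k.+2 then k.+3 else if i == k.+3 then k.+1 else i.

Lemma coef_det_shuffle n k R : (k.+3 < n)%N ->
  coef_det n (R \o shuffle k) = - coef_det n R.
Proof.
move=> lt_kn.
pose R1 i := R (if i == k.+1 then k.+2 else if i == k.+2 then k.+1 else i)%N.
pose R2 i := R1 (if i == k then k.+1 else if i == k.+1 then k else i)%N.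
have -> : coef_det n (R \o shuffle k) = - coef_det n R2.
  by apply: (@coef_det_swap _ k.+2) => [||| i hi hi1] //; congr R;
    rewrite /shuffle; do ?case: eqP; lia.
have -> : coef_det n R2 = - coef_det n R1.
  by apply: (@coef_det_swap _ k) => [||| i hi hi1]; [lia|congr R..];
    do ?case: eqP; lia.
have -> : coef_det n R1 = - coef_det n R.
  by apply: (@coef_det_swap _ k.+1) => [||| i hi hi1]; [lia|congr R..];
    do ?case: eqP; lia.
by rewrite opprK.
Qed.

(** Row permutations are easiest to follow on lists of rows. *)
Definition coef_dets l : K := coef_det (size l) (nth 0 l).

Lemma coef_dets_swap pre a b post :
  coef_dets (pre ++ a :: b :: post) = - coef_dets (pre ++ b :: a :: post).
Proof.
rewrite /coef_dets !size_cat /=; apply: (@coef_det_swap _ (size pre)).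
- by lia.
- by rewrite !nth_cat ltnn subnn ltnNge leqnSn /= subSnn.
- by rewrite !nth_cat ltnn subnn ltnNge leqnSn /= subSnn.
move=> i nei nei1; rewrite !nth_cat; case: ltnP => // le_i.
by case: (i - size pre)%N (subnKC le_i) nei nei1 => [|[|j]] //=; lia.
Qed.

Lemma coef_dets_move pre x l post :
  coef_dets (pre ++ x :: l ++ post) =
  (-1) ^+ size l * coef_dets (pre ++ l ++ x :: post).
Proof.
elim: l pre => [|y l IHl] pre; first by rewrite mul1r.
rewrite cat_cons coef_dets_swap -cat_rcons IHl cat_rcons /=.
by rewrite exprS mulN1r mulNr.
Qed.

Lemma coef_dets_move2 pre x y l post :
  coef_dets (pre ++ x :: y :: l ++ post) =
  coef_dets (pre ++ l ++ x :: y :: post).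
Proof.
rewrite -cat_rcons coef_dets_move cat_rcons coef_dets_move.
by rewrite mulrA -expr2 sqrr_sign mul1r.
Qed.

Lemma det_scale (m : nat) (c : K) (d : nat -> K) (A : nat -> nat -> K) :
  \det (\matrix_(i < m, j < m) (c * d i * d j * A i j)) =
  c ^+ m * (\prod_(i < m) d i) ^+ 2 * \det (\matrix_(i < m, j < m) A i j).
Proof.
pose D : 'rV[K]_m := \row_i d i.
have -> : \matrix_(i < m, j < m) (c * d i * d j * A i j) =
  c *: (diag_mx D *m (\matrix_(i < m, j < m) A i j) *m diag_mx D).
  apply/matrixP => i j; rewrite mul_mx_diag mul_diag_mx !mxE; ring.
rewrite detZ !det_mulmx !det_diag.
under [\prod_i D 0 i]eq_bigr => i _ do rewrite mxE.
by ring.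
Qed.

Lemma det_flip_rows m (A : nat -> nat -> K) :
  \det (\matrix_(i < m, j < m) A (m.-1 - i)%N j) =
  (-1) ^+ perm (@rev_ord_inj m) * \det (\matrix_(i < m, j < m) A i j).
Proof.
rewrite -det_perm -det_mulmx -row_permE; congr (\det _).
apply/matrixP => i j; rewrite !mxE permE /=; congr (A _ j).
by case: m i j => [[]|m] i j //=; rewrite subSS.
Qed.

Lemma coef_det0P n R :
  reflect (exists2 v : nat -> K, exists2 i, (i < n)%N & v i != 0
           & forall j, (j < n)%N -> (\sum_(i < n) v i *: R i)`_j = 0)
          (coef_det n R == 0).
Proof.
apply: (iffP det0P) => [[v nzv vM]|[v [i lt_in nzv] vM]].
  case/rV0Pn: nzv => i nzvi.
  exists (fun k => if insub k is Some k' then v 0 k' else 0).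
    by exists i; rewrite // valK.
  move=> j lt_jn; move/rowP/(_ (Ordinal lt_jn)): vM; rewrite !mxE => vMj.
  by rewrite coef_sum -[RHS]vMj; apply: eq_bigr => k _; rewrite coefZ valK mxE.
exists (\row_(k < n) v k); first by apply/rV0Pn; exists (Ordinal lt_in); rewrite mxE.
apply/rowP => j; rewrite !mxE; apply: etrans (vM j (ltn_ord j)).
rewrite coef_sum.
by apply: eq_bigr => k _; rewrite coefZ !mxE.
Qed.

End CoefDet.

(** * Functions on the affine curve, filtered by the pole at infinity *)

Section Functions.
Variable K : fieldType.
(** The pair (a, b) stands for the function a(X) + b(X) Y. *)
Definition func := ({poly K} * {poly K})%type.
Implicit Types g h : func.

Definition fconj g : func := (g.1, - g.2).
(** The leading behaviour at infinity: with X = Z^2 and Y ~ Z^5 the function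
    (a, b) becomes a(Z^2) + Z^5 b(Z^2), whose degree is the order of the pole
    because the two summands have degrees of different parity. *)
Definition infty g : {poly K} := g.1 \Po 'X^2 + 'X^5 * (g.2 \Po 'X^2).

(** The monomial with a pole of order k. No function has a pole of order 1 or 3,
    and the value for these k is a dummy. *)
Definition mono k : func :=
  if odd k then (0, 'X^((k - 5)./2)) else ('X^(k./2), 0).

(** The Weierstrass gaps at infinity are 1 and 3; this enumerates the other
    orders. *)
Definition pole i : nat := if (i < 2)%N then i.*2 else i.+2.

Lemma coef_infty g i : (infty g)`_i =
  if odd i then (if (i < 5)%N then 0 else g.2`_((i - 5)./2)) else g.1`_(i./2).
Proof.
rewrite coefD coefXnM !coef_comp_poly_Xn // !dvdn2 !divn2.
case: ltnP => [lt_i|le_i]; first by rewrite addr0; case: (odd i).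
have -> : odd (i - 5) = ~~ odd i by lia.
by case: (odd i); rewrite ?addr0 ?add0r.
Qed.

Lemma inftyB g h : infty (g - h) = infty g - infty h.
Proof.
by apply/polyP => i; rewrite coefB !coef_infty /= !coefB;
  do 2?case: ifP; rewrite ?subr0.
Qed.

Lemma inftyZ c g : infty (c *: g) = c *: infty g.
Proof.
by apply/polyP => i; rewrite coefZ !coef_infty /= !coefZ;
  do 2?case: ifP; rewrite ?mulr0.
Qed.

Lemma infty0 : infty 0 = 0.
Proof. by rewrite /infty /= !comp_poly0 mulr0 addr0. Qed.

Lemma infty_sum I (r : seq I) (P : pred I) (F : I -> func) :
  infty (\sum_(i <- r | P i) F i) = \sum_(i <- r | P i) infty (F i).
Proof.
apply: (big_morph infty) => [g h|]; last exact: infty0.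
by rewrite -[h in LHS]opprK inftyB -[- h]sub0r inftyB infty0 sub0r opprK.
Qed.

Lemma infty_eq0 g : infty g = 0 -> g = 0.
Proof.
case: g => a b /polyP ab0; congr pair; apply/polyP => i; rewrite coef0.
  by have := ab0 i.*2; rewrite coef_infty odd_double doubleK coef0.
have := ab0 (i.*2 + 5)%N; rewrite coef_infty coef0 addnK oddD odd_double /=.
by rewrite ltnNge leq_addl /= doubleK.
Qed.

Lemma infty_mono k : k != 1%N -> k != 3%N -> infty (mono k) = 'X^k.
Proof.
move=> k1 k3; apply/polyP => i; rewrite coef_infty coefXn /mono.
case: (boolP (odd k)) => ok /=; rewrite !coefE; case: (boolP (odd i)) => oi.
- case: ltnP => hi; first by rewrite (_ : (i == k) = false) //; lia.
  by congr ((nat_of_bool _)%:R); lia.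
- by rewrite (_ : (i == k) = false) //; lia.
- by rewrite if_same (_ : (i == k) = false) //; lia.
- by congr ((nat_of_bool _)%:R); lia.
Qed.

Lemma infty_basis i : infty (mono (pole i)) = 'X^(pole i).
Proof. by apply: infty_mono; rewrite /pole; case: ifP; lia. Qed.

Lemma coef_infty_conj g i : (infty (fconj g))`_i = (-1) ^+ i * (infty g)`_i.
Proof.
rewrite !coef_infty /= coefN -signr_odd.
by case: (odd i); rewrite ?mul1r //; case: ifP; rewrite ?mulr0 ?mulN1r.
Qed.

Lemma size_infty_conj g k :
  (size (infty g) <= k)%N -> (size (infty (fconj g)) <= k)%N.
Proof.
move=> sg; apply/leq_sizeP => j le_j.
by rewrite coef_infty_conj nth_default ?mulr0 //; apply: leq_trans le_j.
Qed.

(** At infinity the basis functions become distinct powers of Z, so that the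
    coordinates of g are coefficients of its leading behaviour. *)
Lemma basis_expansion n g : (size (infty g) <= (pole n).+1)%N ->
  g = \sum_(j < n.+1) (infty g)`_(pole j) *: mono (pole j).
Proof.
move=> sg; apply/eqP; rewrite -subr_eq0; apply/eqP/infty_eq0.
rewrite inftyB infty_sum; under eq_bigr => j _ do rewrite inftyZ infty_basis.
apply/eqP; rewrite subr_eq0; apply/eqP/polyP => i.
rewrite coef_sum; under eq_bigr => j _ do rewrite coefZ coefXn.
have [gap|notgap] := boolP ((i == 1) || (i == 3))%N.
  rewrite big1 => [|j _].
    by rewrite coef_infty; case/orP: gap => /eqP ->.
  rewrite (_ : (i == pole j) = false) ?mulr0 //.
  by rewrite /pole; case: ifP; move: gap; lia.
pose s := if (i < 4)%N then i./2 else i.-2.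
have sE j : (i == pole j) = (j == s).
  by rewrite /pole /s; case: ifP; case: ifP; move: notgap; lia.
have ps : pole s = i by apply/esym/eqP; rewrite sE.
under eq_bigr => j _ do rewrite sE.
rewrite (eq_bigr (fun j : 'I_n.+1 =>
  if j == s :> nat then (infty g)`_i else 0)); last first.
  by move=> j _; case: eqP => [->|_]; rewrite ?ps ?mulr1 ?mulr0.
rewrite -big_mkcond /= (big_ord1_eq _ (fun=> (infty g)`_i)).
case: ltnP => // lt_ns; rewrite nth_default //; apply: leq_trans sg _.
by rewrite -ps /pole; case: ifP; case: ifP; lia.
Qed.

(** If Y has the power series expansion S at a point where X is a local
    parameter, this is the expansion of g. *)
Definition taylor (S : {poly K}) g : {poly K} := g.1 + g.2 * S.

Lemma taylorZ S c g : taylor S (c *: g) = c *: taylor S g.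
Proof. by rewrite /taylor /= -!mul_polyC; ring. Qed.

Lemma taylor_sum S I (r : seq I) (P : pred I) (F : I -> func) :
  taylor S (\sum_(i <- r | P i) F i) = \sum_(i <- r | P i) taylor S (F i).
Proof.
apply: (big_morph (taylor S)) => [g h|]; rewrite /taylor /= ?mul0r ?addr0 //.
by ring.
Qed.

End Functions.

Section CurveFunctions.
Variables (K : fieldType) (f : {poly K}).
Hypotheses (f_monic : f \is monic) (size_f : size f = 6%N).
Implicit Types g h : func K.

Definition fmul g h : func K :=
  (g.1 * h.1 + g.2 * h.2 * f, g.1 * h.2 + g.2 * h.1).
Definition fnorm g : {poly K} := g.1 ^+ 2 - g.2 ^+ 2 * f.

Lemma coefM_top (R : nzRingType) (p q : {poly R}) k l :
  (size p <= k.+1)%N -> (size q <= l.+1)%N -> (p * q)`_(k + l) = p`_k * q`_l.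
Proof.
move=> sp sq; have lt_k : (k < (k + l).+1)%N by lia.
rewrite coefM (bigD1 (Ordinal lt_k)) //= addKn big1 ?addr0 // => i.
rewrite -val_eqE /= => neq_ik; case: (ltnP i k) => hi.
  by rewrite [q`_ _]nth_default ?mulr0 //; apply: leq_trans sq _; lia.
by rewrite nth_default ?mul0r //; apply: leq_trans sp _; lia.
Qed.

(** The substitution is not multiplicative, as it replaces Y^2 = f(X) by Z^10;
    but f has degree 5 and leading coefficient 1, so the error stays below the
    product of the leading terms. *)
Lemma infty_mul g h k l :
    (size (infty g) <= k.+1)%N -> (size (infty h) <= l.+1)%N ->
  (size (infty (fmul g h)) <= (k + l).+1)%N
  /\ (infty (fmul g h))`_(k + l) = (infty g)`_k * (infty h)`_l.
Proof.
move=> sg sh; pose B (g : func K) := g.2 \Po 'X^2.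
pose f0 := f - 'X^5.
have sf0 : (size (f0 \Po 'X^2) <= 9)%N.
  apply: leq_trans (size_comp_poly_leq _ _) _; rewrite size_polyXn /=.
  suff : (size f0 <= 5)%N by move: (size f0) => m; lia.
  apply/leq_sizeP => j; rewrite leq_eqVlt => /predU1P[<-|lt5].
    rewrite coefB coefXn eqxx.
    by move: f_monic; rewrite monicE lead_coefE size_f => /eqP ->; rewrite subrr.
  rewrite coefB coefXn nth_default ?size_f // (_ : (j == 5) = false) ?subrr //.
  by lia.
have sB (u : func K) m : (size (infty u) <= m.+1)%N -> (size (B u) <= m - 4)%N.
  move=> su; apply/leq_sizeP => j le_j; rewrite coef_comp_poly_Xn //.
  case: ifP => // /dvdnP[i def_j]; rewrite def_j mulnK //.
  have := leq_sizeP _ _ su (i.*2 + 5)%N; rewrite coef_infty oddD odd_double /=.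
  rewrite (_ : (i.*2 + 5 < 5)%N = false); last by lia.
  by rewrite addnK doubleK => -> //; lia.
have infM : infty (fmul g h)
              = infty g * infty h + B g * B h * (f0 \Po 'X^2).
  rewrite /infty /fmul /B /f0 /= comp_polyB comp_Xn_poly !comp_polyD !comp_polyM.
  by ring.
have D0 i : (k + l <= i.+1)%N -> (B g * B h * (f0 \Po 'X^2))`_i = 0.
  move=> le_i; have sBg := sB _ _ sg; have sBh := sB _ _ sh.
  have := size_polyMleq (B g) (B h); have := size_polyMleq (B g * B h) (f0 \Po 'X^2).
  have [->|nzg] := eqVneq (B g) 0; first by rewrite !mul0r coef0.
  have [->|nzh] := eqVneq (B h) 0; first by rewrite mulr0 mul0r coef0.
  move: nzg nzh; rewrite -!size_poly_gt0 => gt0 gt0' le1 le2.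
  rewrite nth_default //; move: sBg sBh sf0 gt0 gt0' le1 le2 le_i.
  move: (size _) (size _) (size _) (size _) (size _) => n1 n2 n3 n4 n5; lia.
split; last by rewrite infM coefD D0 ?addr0 ?coefM_top // leqnSn.
apply/leq_sizeP => j lt_j; rewrite infM coefD D0 ?addr0; last by lia.
by rewrite nth_default //; apply: leq_trans (size_polyMleq _ _) _; lia.
Qed.

Lemma fmul_conj g : fmul g (fconj g) = (fnorm g, 0).
Proof. by rewrite /fmul /fnorm /=; congr pair; ring. Qed.

Lemma coef_fnorm g k : (size (infty g) <= k.+1)%N ->
  (size (fnorm g) <= k.+1)%N /\ (fnorm g)`_k = (-1) ^+ k * (infty g)`_k ^+ 2.
Proof.
move=> sg; have [sN cN] := infty_mul sg (size_infty_conj sg).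
have cE i : (fnorm g)`_i = (infty (fmul g (fconj g)))`_(i.*2).
  by rewrite fmul_conj coef_infty odd_double doubleK.
split; last by rewrite cE -addnn cN coef_infty_conj; ring.
by apply/leq_sizeP => j lt_j; rewrite cE nth_default //; apply: leq_trans sN _; lia.
Qed.

Lemma size_fnorm g : size (fnorm g) = size (infty g).
Proof.
have [/infty_eq0 ->|nzg] := eqVneq (infty g) 0.
  by rewrite infty0 /fnorm /= expr0n /= mul0r subr0.
have [k def_k] : exists k, size (infty g) = k.+1.
  by exists (size (infty g)).-1; rewrite prednK // size_poly_gt0.
have sg : (size (infty g) <= k.+1)%N by rewrite def_k.
have [sN cN] := coef_fnorm sg; apply/eqP; rewrite eqn_leq def_k sN ltnNge.
apply/negP => /leq_sizeP/(_ k (leqnn k))/eqP; rewrite cN.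
rewrite mulf_eq0 signr_eq0 /= expf_eq0 /= -[k]/(k.+1.-1) -def_k -lead_coefE.
by rewrite lead_coef_eq0 (negPf nzg).
Qed.

Lemma fnorm_eq0 g : (fnorm g == 0) = (g == 0).
Proof.
rewrite -size_poly_eq0 size_fnorm size_poly_eq0.
by apply/eqP/eqP => [/infty_eq0//|->]; rewrite infty0.
Qed.

Lemma fnormM g h : fnorm (fmul g h) = fnorm g * fnorm h.
Proof. by rewrite /fnorm /fmul /=; ring. Qed.

Lemma taylor_mul S T E g h : S ^+ 2 = f + 'X^T * E ->
  taylor S (fmul g h) = taylor S g * taylor S h - 'X^T * (E * g.2 * h.2).
Proof.
move=> S2; have -> : 'X^T * (E * g.2 * h.2) = (S ^+ 2 - f) * g.2 * h.2.
  by rewrite S2; ring.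
by rewrite /taylor /fmul /=; ring.
Qed.

End CurveFunctions.

(** * Quasi-periodicity of the Taylor determinants *)

Section Expansion.
Variable K : fieldType.

Lemma polyXn_dvd (p : {poly K}) T : (forall j, (j < T)%N -> p`_j = 0) ->
  exists E, p = 'X^T * E.
Proof.
move=> p0; exists (drop_poly T p); rewrite -{1}(poly_take_drop T p).
rewrite (_ : take_poly T p = 0) ?add0r 1?mulrC //.
by apply/polyP => j; rewrite coef_take_poly coef0; case: ifP => // /p0.
Qed.

Lemma polyXn_inv (p : {poly K}) T : p`_0 != 0 ->
  exists q E, q * p = 1 + 'X^T * E.
Proof.
move=> p0; have : coprimep p ('X^T).
  by rewrite coprimep_expr // coprimepX /root horner_coef0.
case/Bezout_coprimepP => -[a b] /= /eqpP[[c d]] /= /andP[nzc nzd] eq1.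
exists ((c / d) *: a), (- (c / d) *: b).
have -> : (1 : {poly K}) = d^-1 *: (c *: (a * p + b * 'X^T)).
  by rewrite eq1 scalerA mulVf // scale1r.
by rewrite -!mul_polyC polyCN polyCM; ring.
Qed.

Lemma size_infty_basis i : size (infty (mono K (pole i))) = (pole i).+1.
Proof. by rewrite infty_basis size_polyXn. Qed.

(* The expansion of Y at a point with X = 0. *)
Variable s : nat -> K.

Definition trunc_series T : {poly K} := \poly_(i < T) s i.

Lemma coef_taylor_trunc (g : func K) T T' j : (j < T)%N -> (j < T')%N ->
  (taylor (trunc_series T) g)`_j = (taylor (trunc_series T') g)`_j.
Proof.
move=> ltT ltT'; rewrite !coefD !coefM; congr (_ + _); apply: eq_bigr => i _.
by rewrite !coef_poly !ifT //; case: i => i /=; lia.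
Qed.

(** For n >= 2 the first n functions [mono (pole i)] are a basis of the functions
    with a pole of order at most n + 1 at infinity. The determinant vanishes when
    a nonzero one among them has a zero of order n at the point. *)
Definition tau n : K :=
  coef_det n (fun i => taylor (trunc_series n) (mono K (pole i))).

Lemma tauE n T : (n <= T)%N ->
  tau n = coef_det n (fun i => taylor (trunc_series T) (mono K (pole i))).
Proof.
move=> le_nT; apply: eq_coef_det => i j _ lt_j.
by apply: coef_taylor_trunc => //; apply: leq_trans le_nT.
Qed.

End Expansion.

Section Torsion.
Variables (K : fieldType) (f : {poly K}).
Variable s : nat -> K.
Hypothesis s_sqr : forall j, \sum_(i < j.+1) s i * s (j - i)%N = f`_j.

Lemma trunc_series_sqr T : exists E, trunc_series s T ^+ 2 = f + 'X^T * E.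
Proof.
have [|E defE] := @polyXn_dvd _ (trunc_series s T ^+ 2 - f) T; last first.
  by exists E; rewrite -defE addrC subrK.
move=> j lt_j; rewrite coefB expr2 coefM -s_sqr; apply/eqP; rewrite subr_eq0.
by apply/eqP/eq_bigr => i _; rewrite !coef_poly !ifT //; case: i => i /=; lia.
Qed.

Hypotheses (f_monic : f \is monic) (size_f : size f = 6%N).
Variables (g : func K) (r : nat).
Hypothesis norm_g : fnorm f g = (-1) ^+ r *: 'X^r.
Hypothesis size_g : (size (infty g) <= r.+1)%N.
Hypothesis lead_g : (infty g)`_r = 1.
Hypothesis conj_g : g.1`_0 - g.2`_0 * s 0%N != 0.
Hypothesis r_ge5 : (5 <= r)%N.

(** The conjugate of g does not vanish at the point, and its product with g is the
    norm of g, which is X^r up to sign: so g is X^r times a local unit u. *)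
Lemma taylor_torsion T : (r < T)%N -> exists u E,
  [/\ taylor (trunc_series s T) g = 'X^r * u,
      u * taylor (trunc_series s T) (fconj g) = ((-1) ^+ r)%:P + 'X^(T - r) * E
    & u`_0 = (-1) ^+ r / (g.1`_0 - g.2`_0 * s 0%N)].
Proof.
move=> ltT; have [E S2] := trunc_series_sqr T.
set S := trunc_series s T in S2 *; set tg' := taylor S (fconj g).
have tg'0 : tg'`_0 = g.1`_0 - g.2`_0 * s 0%N.
  by rewrite coefD coef0M /= coefN coef_poly (leq_trans _ ltT) // mulNr.
have := taylor_mul g (fconj g) S2.
rewrite fmul_conj /taylor /= -/(taylor S g) -/tg' norm_g mul0r addr0.
rewrite -{1}(subnKC (ltnW ltT)) exprD -mul_polyC => eqN.
have eqXr : taylor S g * tg' =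
    'X^r * (((-1) ^+ r)%:P + 'X^(T - r) * (E * g.2 * - g.2)).
  by rewrite -[LHS](subrK ('X^r * 'X^(T - r) * (E * g.2 * - g.2))) -eqN; ring.
have cop : coprimep ('X^r) tg'.
  rewrite coprimep_sym coprimep_expr // coprimepX /root horner_coef0 tg'0.
  exact: conj_g.
have : 'X^r %| taylor S g by rewrite -(Gauss_dvdpl _ cop) eqXr dvdp_mulr.
case/dvdpP => u def_u; exists u, (E * g.2 * - g.2); rewrite mulrC.
have eq2 : u * tg' = ((-1) ^+ r)%:P + 'X^(T - r) * (E * g.2 * - g.2).
  apply: (@mulfI _ ('X^r)); first by rewrite -size_poly_eq0 size_polyXn.
  by rewrite -eqXr def_u; ring.
split=> //; apply: (canRL (mulfK conj_g)); rewrite -tg'0 -coef0M eq2.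
by rewrite coefD coefC coefXnM subn_gt0 ltT addr0.
Qed.

(** The multiples of g by basis functions have poles of order r + pole i. The
    values at i < r are the r pole orders that remain. *)
Definition pole' i : nat :=
  if (i < r - 2)%N then pole i else if (i == r - 2)%N then r.+1 else r.+3.

Definition kappa : K :=
  coef_det r (fun i => taylor (trunc_series s r) (mono K (pole' i))).

(* The leading Taylor coefficient of g, by the product formula for the norm. *)
Let u0 : K := (-1) ^+ r / (g.1`_0 - g.2`_0 * s 0%N).

Lemma infty_pole' i : (i < r)%N -> infty (mono K (pole' i)) = 'X^(pole' i).
Proof.
move=> lt_i; apply: infty_mono; rewrite /pole' /pole; do 3?case: ifP; lia.
Qed.

Lemma pole'_shuffle i : (shuffle (r - 2)%N i < r)%N ->
  pole' (shuffle (r - 2)%N i) = pole i.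
Proof. by rewrite /pole' /pole /shuffle; do ?case: ifP; lia. Qed.

Lemma pole_shuffle i : (r <= shuffle (r - 2)%N i)%N ->
  pole i = (r + pole (shuffle (r - 2)%N i - r))%N.
Proof. by rewrite /pole /shuffle; do ?case: ifP; lia. Qed.

(** The basis functions with an index below n + r may be replaced by functions
    with the same leading terms at infinity. Multiples of g are chosen where
    possible; they vanish to the order r, which makes the matrix block
    triangular. *)
Lemma tau_shift n : (2 <= n)%N -> tau s (r + n) = - kappa * u0 ^+ n * tau s n.
Proof.
move=> n_ge2; set T := (r + n)%N; have ltT : (r < T)%N by rewrite /T; lia.
have [E S2] := trunc_series_sqr T.
have [u [_ [tgE _ u0E]]] := taylor_torsion ltT; set S := trunc_series s T in S2 tgE *.
pose q i := if (i < r)%N then mono K (pole' i) else fmul f g (mono K (pole (i - r))).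
pose sg := shuffle (r - 2)%N.
pose R i := taylor S (q i).
have R_sg : coef_det T (R \o sg) = - coef_det T R.
  by apply: coef_det_shuffle; rewrite /T; lia.
have [size_q lead_q] :
     (forall i, (i < T)%N -> (size (infty (q (sg i))) <= (pole i).+1)%N)
   /\ (forall i, (i < T)%N -> (infty (q (sg i)))`_(pole i) = 1).
  suff main i : (i < T)%N -> (size (infty (q (sg i))) <= (pole i).+1)%N
                /\ (infty (q (sg i)))`_(pole i) = 1.
    by split=> i /main[].
  move=> lt_i; rewrite /q; case: ltnP => [lt_sg|le_sg].
    rewrite (pole'_shuffle lt_sg).
    by rewrite infty_basis size_polyXn coefXn eqxx.
  rewrite (pole_shuffle le_sg).
  have [|-> ->] := infty_mul f_monic size_f (h := mono K (pole (sg i - r)))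
    size_g (l := pole (sg i - r)).
    by rewrite size_infty_basis.
  by rewrite lead_g infty_basis coefXn eqxx mulr1.
have -> : tau s T = coef_det T (R \o sg).
  apply/esym/(coef_det_unitriangular (B := fun i j => (infty (q (sg i)))`_(pole j))) => //.
  move=> i lt_i; rewrite /R /= {1}(basis_expansion (size_q i lt_i)).
  by rewrite taylor_sum; apply: eq_bigr => j _; rewrite taylorZ.
rewrite R_sg coef_det_ublock => [|i j /andP[le_i lt_i] lt_j]; last first.
  rewrite /R /q ltnNge le_i /= (taylor_mul _ _ S2) tgE coefB -mulrA !coefXnM lt_j.
  by rewrite ifT ?subrr //; lia.
rewrite -!mulNr -mulrA; congr (- _ * _).
  apply: eq_coef_det => i j lt_i lt_j; rewrite /R /q lt_i.
  by apply: coef_taylor_trunc => //; apply: ltn_trans ltT.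
rewrite (tauE _ (leq_addl r n)) /u0 -u0E -coef_det_mul; congr (\det _).
apply/matrixP => i j; rewrite !mxE /R /q ifF ?addKn; last by lia.
rewrite (taylor_mul _ _ S2) tgE coefB -mulrA !coefXnM ifF; last by lia.
by rewrite addKn ifT ?subr0 // /T ltn_add2l.
Qed.

Hypothesis two_neq0 : (2 : K) != 0.
Hypothesis s0_neq0 : s 0%N != 0.

Lemma u0_neq0 : u0 != 0.
Proof. by rewrite mulf_neq0 ?signr_eq0 ?invr_eq0. Qed.

(** As g has the expansion X^r u, the coefficient of X^(r - 1) in the expansion of
    h divided by S u is the residue at the point of the differential
    h dX / (Y g). If the pole of h at infinity has order at most r + 2, this
    differential has no other pole, and the residue vanishes. One order more
    leaves a simple pole at infinity, whose residue is, up to sign, twice the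
    leading coefficient of h because dX = 2 Z dZ for X = Z^2. The residue theorem
    enters through the identity between h and its conjugate: the sum of the
    residues at the point and at its conjugate is a coefficient of a polynomial,
    and the second one is 0. *)
Lemma residue_pairing T : (r.*2 <= T)%N -> exists v : {poly K},
  v`_0 = (s 0%N * u0)^-1
  /\ forall h, (size (infty h) <= r.+4)%N ->
     (taylor (trunc_series s T) h * v)`_r.-1 = 2 * (infty h)`_(r.+3).
Proof.
move=> leT; have ltT : (r < T)%N by lia.
have [E S2] := trunc_series_sqr T.
have [u [E1 [tgE uE u0E]]] := taylor_torsion ltT.
have S0 : (trunc_series s T)`_0 = s 0%N by rewrite coef_poly ifT //; lia.
set S := trunc_series s T in S2 tgE uE S0 *.
have Su0 : (S * u)`_0 = s 0%N * u0 by rewrite coef0M S0 u0E.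
have [|v [E2 vE]] := @polyXn_inv _ (S * u) r.
  by rewrite Su0 mulf_neq0 // u0_neq0.
exists v; split.
  have /(congr1 (coefp 0)) := vE; rewrite /coefp coef0M coefD coefXnM Su0.
  rewrite ifT ?addr0 ?coef1; last by lia.
  by move=> /(canRL (mulfK _)) ->; rewrite ?mul1r // mulf_neq0 // u0_neq0.
move=> h size_h; set B := (fmul f h (fconj g)).2.
pose c : {poly K} := ((-1) ^+ r)%:P.
have c2 : c * c = 1 by rewrite -polyCM -expr2 sqrr_sign.
have [E3 eqB] : exists E3, taylor S h * v = 2 * c * B + 'X^r * E3.
  have := taylor_mul h (fconj g) S2; have := taylor_mul (fconj h) g S2.
  have -> : taylor S (fmul f (fconj h) g) = taylor S (fmul f h (fconj g)) - 2 * B * S.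
    by rewrite /taylor /B /=; ring.
  move=> conj_eq mul_eq; rewrite tgE in conj_eq.
  set e1 := E * h.2 * _ in mul_eq; set e2 := E * _ * g.2 in conj_eq.
  have XT : 'X^T = 'X^r * 'X^(T - r) :> {poly K} by rewrite -exprD subnKC // ltnW.
  have XTr : 'X^(T - r) = 'X^r * 'X^(T - r.*2) :> {poly K}.
    by rewrite -exprD; congr 'X^_; lia.
  have thE : taylor S h * taylor S (fconj g) =
      2 * B * S + taylor S (fconj h) * ('X^r * u) - 'X^T * e2 + 'X^T * e1.
    by rewrite -[LHS](subrK ('X^T * e1)) -mul_eq; congr (_ + _);
       rewrite -addrA -conj_eq addrC subrK.
  move: uE thE; rewrite -/c XTr XT XTr.
  move: (taylor S (fconj g)) (taylor S (fconj h)) (taylor S h) => tg' th' th.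
  move: ('X^(T - r.*2)) => X2 uE thE.
  exists (2 * c * B * E2 + c * u * v * (th' * u + 'X^r * X2 * (e1 - e2))
          - th * v * c * X2 * E1).
  rewrite -[th in LHS]mulr1 -{1}c2.
  have -> : th * (c * c) * v = c * v * u * (th * tg') - c * v * th * (u * tg' - c) by ring.
  rewrite thE uE; set Xr := 'X^r in vE *.
  have -> : c * v * u * (2 * B * S + th' * (Xr * u) - Xr * (Xr * X2) * e2 +
    Xr * (Xr * X2) * e1) = 2 * c * B * (v * (S * u)) +
    c * v * u * (th' * (Xr * u) - Xr * (Xr * X2) * e2 +
    Xr * (Xr * X2) * e1) by ring.
  by rewrite vE; ring.
have -> : 2 * (infty h)`_r.+3 = (2 * c * B)`_r.-1.
  have [_] := infty_mul f_monic size_f (h := fconj g) (l := r)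
    size_h (size_infty_conj size_g).
  rewrite coef_infty_conj lead_g mulr1 coef_infty ifT; last by lia.
  rewrite ifF; last by lia.
  have -> : ((r.+3 + r - 5)./2 = r.-1)%N by lia.
  rewrite -/B => BE; rewrite -mulrA !mulr_natl coefMn coefCM BE.
  by rewrite mulrCA -expr2 sqrr_sign mulr1.
by rewrite eqB coefD coefXnM ifT ?addr0 //; lia.
Qed.

(** By [residue_pairing] the functions for m and for k pair to 0, so that the
    product of the r x r matrix M behind kappa with the k columns Z that the
    pairing defines is 0 in the first m rows and antitriangular below. Completing
    Z by unit columns to a square matrix and comparing determinants expresses the
    leading minor of size m through that of size k. The signs of the two reversals
    of k rows cancel. *)
Lemma tau_reflect m k : (m + k = r)%N -> (2 <= m)%N -> (2 <= k)%N ->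
  kappa * tau s k = (2 * s 0%N * u0) ^+ k * tau s m.
Proof.
move=> mk m_ge2 k_ge2; pose T := r.*2.
have [E S2] := trunc_series_sqr T.
have [v [v0 residue]] := residue_pairing (leqnn T).
set S := trunc_series s T in S2 residue.
pose F i := taylor S (mono K (pole' i)).
pose M := \matrix_(i < m + k, l < m + k) (F i)`_l.
pose Z := \matrix_(l < m + k, j < k) (v * F j)`_(r.-1 - l).
have poleE i : (i < r - 2)%N -> pole' i = pole i by rewrite /pole' => ->.
have lt_mr : (m <= r - 2)%N by lia.
have lt_kr : (k <= r - 2)%N by lia.
have detM : \det M = kappa.
  rewrite /kappa -mk; apply: eq_coef_det => i j lt_i lt_j.
  by apply: coef_taylor_trunc => //; rewrite /T; lia.
have tauF n : (n <= r - 2)%N -> coef_det n F = tau s n.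
  move=> le_n; rewrite (tauE _ (_ : n <= T)%N); last by rewrite /T; lia.
  by apply: eq_coef_det => i j lt_i _; rewrite /F poleE //; apply: leq_trans le_n.
have MZE i j : (i + j < r)%N -> (j < k)%N ->
    (F i * (v * F j))`_r.-1 = 2 * (i + j == r.-1)%N%:R.
  move=> lt_ij lt_j; have lt_i : (i < r)%N by lia.
  have lt_jr : (j < r)%N by lia.
  have := infty_mul f_monic size_f (g := mono K (pole' i)) (h := mono K (pole' j))
    (k := pole' i) (l := pole' j).
  rewrite !infty_pole' // !size_polyXn !leqnn !coefXn !eqxx mul1r.
  case=> // size_ij lead_ij.
  have -> : (F i * (v * F j))`_r.-1 =
     (taylor S (fmul f (mono K (pole' i)) (mono K (pole' j))) * v)`_r.-1.
    rewrite (taylor_mul _ _ S2) mulrBl coefB -['X^T * _ * v]mulrA coefXnM ifT.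
      by rewrite subr0 mulrA (mulrAC (F i)).
    by rewrite /T; lia.
  have sum_pole : if (i + j == r.-1)%N then (pole' i + pole' j = r.+3)%N
                  else (pole' i + pole' j < r.+3)%N.
    by rewrite /pole' /pole; case: eqP; do ?case: ifP; lia.
  rewrite residue; last first.
    by apply: leq_trans size_ij _; case: eqP sum_pole; lia.
  case: eqP sum_pole => [_ eq3|_ lt3]; first by rewrite -eq3 lead_ij.
  by congr (_ * _); rewrite nth_default //; apply: leq_trans size_ij _.
have MZ i j : (M *m Z) i j = (F i * (v * F j))`_r.-1.
  rewrite mxE coefM prednK; last by lia.
  rewrite -(big_mkord xpredT (fun l => (F i)`_l * (v * F j)`_(r.-1 - l))).
  rewrite -[X in index_iota 0 X]mk big_mkord.
  by apply: eq_bigr => l _; rewrite !mxE.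
have MZ0 : usubmx (M *m Z) = 0.
  apply/matrixP => i j; rewrite mxE MZ /= MZE //; last first.
    by move: (ltn_ord i) (ltn_ord j); lia.
  by rewrite (_ : (_ == _) = false) ?mulr0 ?mxE //;
    move: (ltn_ord i) (ltn_ord j); lia.
have : \det (M *m block_mx 1%:M (usubmx Z) 0 (dsubmx Z)) =
       \det (block_mx (ulsubmx M) 0 (dlsubmx M) (dsubmx (M *m Z))).
  congr (\det _); rewrite !block_mxEh !vsubmxK -MZ0 vsubmxK mul_mx_row.
  congr row_mx.
  rewrite -[M in LHS]hsubmxK mul_row_col mulmx1 mulmx0 addr0 -[LHS]vsubmxK.
  by congr col_mx; apply/matrixP => i j; rewrite !mxE.
rewrite det_mulmx det_ublock det1 mul1r det_lblock detM.
pose A i j := (v * F j)`_i.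
have -> : dsubmx Z = \matrix_(i < k, j < k) A (k.-1 - i)%N j.
  by apply/matrixP => i j; rewrite !mxE /A; congr (_`_ _) => /=; lia.
rewrite det_flip_rows.
have -> : \det (\matrix_(i < k, j < k) A i j) = v`_0 ^+ k * tau s k.
  rewrite -det_tr -tauF // -coef_det_mul; congr (\det _).
  by apply/matrixP => i j; rewrite !mxE.
pose A' i j := (F (m + (k.-1 - i))%N * (v * F j))`_r.-1.
have -> : dsubmx (M *m Z) = \matrix_(i < k, j < k) A' (k.-1 - i)%N j.
  apply/matrixP => i j; rewrite mxE MZ mxE /A' /=; congr ((F _ * _)`_ _).
  by move: (ltn_ord i); lia.
rewrite det_flip_rows.
have -> : \det (\matrix_(i < k, j < k) A' i j) = 2 ^+ k.
  have A'E (i j : 'I_k) : (j <= i)%N -> A' i j = 2 * (i == j)%:R.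
    move: (ltn_ord i) => lt_i le_ji; rewrite /A' MZE //; last by lia.
    by congr (_ * (nat_of_bool _)%:R); rewrite -val_eqE /=; lia.
  rewrite -det_tr det_trig; last first.
    apply/is_trig_mxP => i j lt_ij; rewrite !mxE A'E 1?ltnW //.
    by rewrite -val_eqE gtn_eqF // mulr0.
  under eq_bigr => i _ do rewrite !mxE A'E // eqxx mulr1.
  by rewrite prodr_const card_ord.
have -> : \det (ulsubmx M) = tau s m.
  by rewrite -tauF //; congr (\det _); apply/matrixP => i j; rewrite !mxE.
have nz : s 0%N * u0 != 0 by rewrite mulf_neq0 // u0_neq0.
rewrite v0 mulrCA [RHS]mulrCA => /(mulfI _) eq_tau.
have -> : (2 * s 0%N * u0) ^+ k * tau s m = (s 0%N * u0) ^+ k * (tau s m * 2 ^+ k).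
  by rewrite -[2 * _ * _]mulrA [(2 * _) ^+ k]exprMn; ring.
rewrite -eq_tau ?signr_eq0 // exprVn mulrCA mulVKf //.
by rewrite expf_neq0.
Qed.

End Torsion.

(** * Zeros of the Taylor determinants *)

Section TauZeros.
Variables (K : fieldType) (s : nat -> K).

Lemma tau_eq0 n : tau s n = 0 -> exists h : func K,
  [/\ h != 0, (size (infty h) <= n.+2)%N
    & forall T j, (j < n)%N -> (n <= T)%N -> (taylor (trunc_series s T) h)`_j = 0].
Proof.
move/eqP/coef_det0P => [v [i lt_i nzv] vM].
pose h := \sum_(j < n) v j *: mono K (pole j).
have hE : infty h = \sum_(j < n) v j *: 'X^(pole j).
  by rewrite infty_sum; apply: eq_bigr => j _; rewrite inftyZ infty_basis.
exists h; split.
- apply: contraNneq nzv => h0; have : (infty h)`_(pole i) = 0.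
    by rewrite h0 infty0 coef0.
  rewrite hE coef_sum (bigD1 (Ordinal lt_i)) //= coefZ coefXn eqxx mulr1.
  rewrite big1 ?addr0 => [->//|j]; rewrite -val_eqE /= => ne_ji.
  rewrite coefZ coefXn (_ : (_ == _) = false) ?mulr0 //.
  by move: ne_ji; rewrite /pole; do 2?case: ifP; lia.
- rewrite hE (leq_trans (size_sum _ _ _)) //; apply/bigmax_leqP => j _.
  rewrite (leq_trans (size_scale_leq _ _)) // size_polyXn.
  by move: (ltn_ord j); rewrite /pole; case: ifP; lia.
move=> T j lt_jn le_nT.
rewrite (@coef_taylor_trunc _ _ _ T n) ?(leq_trans lt_jn) //.
rewrite taylor_sum -[RHS](vM j lt_jn).
by under eq_bigr => k _ do rewrite taylorZ.
Qed.

Lemma tau_eq0_of n (h : func K) :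
    (3 <= n)%N -> h != 0 -> (size (infty h) <= n.+2)%N ->
  (forall j, (j < n)%N -> (taylor (trunc_series s n) h)`_j = 0) -> tau s n = 0.
Proof.
move=> n_ge3 nzh sh vanish.
have [m def_n] : exists m, n = m.+1 by exists n.-1; lia.
have sh' : (size (infty h) <= (pole m).+1)%N.
  by apply: leq_trans sh _; rewrite /pole; case: ifP; lia.
have defh := basis_expansion sh'.
apply/eqP/coef_det0P; exists (fun j => (infty h)`_(pole j)).
  have [/existsP[j nzj]|] := boolP [exists j : 'I_n, (infty h)`_(pole j) != 0].
    by exists j.
  rewrite negb_exists => /forallP all0; case/eqP: nzh; rewrite defh big1 // => j _.
  have lt_j : (j < n)%N by rewrite def_n.
  by have := all0 (Ordinal lt_j); rewrite negbK => /eqP ->; rewrite scale0r.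
move=> j lt_j; rewrite -[RHS](vanish j lt_j) [in RHS]defh taylor_sum -def_n.
by under [in RHS]eq_bigr => k _ do rewrite taylorZ.
Qed.

Lemma mul_polyXn_eq0 (p q : {poly K}) n : p`_0 != 0 ->
  (forall j, (j < n)%N -> (p * q)`_j = 0) -> forall j, (j < n)%N -> q`_j = 0.
Proof.
move=> p0 pq0; have [E pqE] := polyXn_dvd pq0.
have cop : coprimep ('X^n) p.
  by rewrite coprimep_sym coprimep_expr // coprimepX /root horner_coef0.
have : 'X^n %| q by rewrite -(Gauss_dvdpr _ cop) pqE dvdp_mulr.
by case/dvdpP => E' -> j lt_j; rewrite coefMXn lt_j.
Qed.

End TauZeros.

Section Zeros.
Variables (K : fieldType) (f : {poly K}).
Hypotheses (f_monic : f \is monic) (size_f : size f = 6%N).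
Variable s : nat -> K.

(** The functions with divisor r [P] - r [infinity]: their norm is a multiple
    of X^r, and they do not vanish at the conjugate of P. *)
Definition torsion_function (r : nat) (g : func K) : Prop :=
  [/\ fnorm f g = (fnorm f g)`_r *: 'X^r, fnorm f g != 0
    & g.1`_0 - g.2`_0 * s 0%N != 0].

(** A function that is a polynomial in X and vanishes at P also vanishes at the
    conjugate of P; so Y occurs in g, which makes the order of its pole at least
    5. *)
Lemma torsion_function_normalized r g : (0 < r)%N -> torsion_function r g ->
  exists g' : func K,
    [/\ fnorm f g' = (-1) ^+ r *: 'X^r, (size (infty g') <= r.+1)%N,
        (infty g')`_r = 1, g'.1`_0 - g'.2`_0 * s 0%N != 0 & (5 <= r)%N].
Proof.
move=> r_gt0 [normE norm0 conj0].
have c0 : (fnorm f g)`_r != 0.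
  by apply: contraNneq norm0 => c0; rewrite normE c0 scale0r.
have sg : size (infty g) = r.+1.
  by rewrite -(size_fnorm f_monic size_f) normE size_scale // size_polyXn.
set l := (infty g)`_r; have l0 : l != 0.
  by rewrite /l -[r]/(r.+1.-1) -sg -lead_coefE lead_coef_eq0 -size_poly_eq0 sg.
have lead' : (infty (l^-1 *: g))`_r = 1 by rewrite inftyZ coefZ mulVf.
have size' : (size (infty (l^-1 *: g)) <= r.+1)%N.
  by rewrite inftyZ (leq_trans (size_scale_leq _ _)) ?sg.
exists (l^-1 *: g); split=> //.
- have [_] := coef_fnorm f_monic size_f size'; rewrite lead' expr1n mulr1 => <-.
  have -> : fnorm f (l^-1 *: g) = l^-1 ^+ 2 *: fnorm f g.
    by rewrite /fnorm /= -!mul_polyC polyC_exp; ring.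
  by rewrite coefZ normE coefZ coefXn eqxx mulr1 scalerA.
- by rewrite /= !coefZ -mulrA -mulrBr mulf_neq0 // invr_eq0.
have nz2 : g.2 != 0.
  apply: contraNneq conj0 => g2; rewrite g2 coef0 mul0r subr0.
  have : (fnorm f g)`_0 = 0 by rewrite normE coefZ coefXn ltn_eqF ?mulr0.
  rewrite /fnorm g2 expr0n mul0r subr0 expr2 coef0M => /eqP.
  by rewrite mulf_eq0 orbb.
have := leq_sizeP _ _ (_ : size (infty g) <= r.+1)%N ((size g.2).-1.*2 + 5)%N.
rewrite sg coef_infty oddD odd_double /= (_ : (_ + 5 < 5)%N = false); last by lia.
rewrite addnK doubleK -lead_coefE => lead2.
rewrite leqNgt; apply/negP => lt5; case/eqP: nz2; apply/eqP.
by rewrite -lead_coef_eq0 lead2 //; lia.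
Qed.

Hypothesis s_sqr : forall j, \sum_(i < j.+1) s i * s (j - i)%N = f`_j.
(** On the multiples (r - 1) P, r P and (r + 1) P the functions g, g and X g
    show that the determinant vanishes. *)
Lemma tau_torsion_eq0 r (g : func K) n : fnorm f g = (-1) ^+ r *: 'X^r ->
    (size (infty g) <= r.+1)%N -> g.1`_0 - g.2`_0 * s 0%N != 0 -> (5 <= r)%N ->
  (r.-1 <= n <= r.+1)%N -> tau s n = 0.
Proof.
move=> norm_g size_g conj_g r_ge5 /andP[le_n ge_n].
have n_ge3 : (3 <= n)%N by lia.
have nzg : g != 0.
  by apply: contraNneq conj_g => ->; rewrite /= coef0 mul0r subr0.
have vanish T j : (r < T)%N -> (j < r)%N -> (taylor (trunc_series s T) g)`_j = 0.
  move=> lt_rT lt_j.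
  have [u [_ [-> _ _]]] := taylor_torsion s_sqr norm_g conj_g lt_rT.
  by rewrite coefXnM lt_j.
have [def_n|ne_n] := eqVneq n r.+1; last first.
  have lt_nr : (n <= r)%N by rewrite -ltnS ltn_neqAle ne_n.
  apply: (tau_eq0_of _ nzg) => // [|j lt_jn].
    by apply: leq_trans size_g _; clear -le_n; lia.
  have lt_jr := leq_trans lt_jn lt_nr.
  by rewrite (@coef_taylor_trunc _ _ _ _ r.+1) ?vanish // ltnW.
rewrite {n le_n ge_n}def_n in n_ge3 *.
apply: (tau_eq0_of (h := ('X * g.1, 'X * g.2))) => //.
- apply: contraNneq conj_g => -[/eqP g1 /eqP g2].
  move: g1 g2; rewrite !mulf_eq0 polyX_eq0 /= => /eqP -> /eqP ->.
  by rewrite !coef0 mul0r subr0.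
- have -> : infty ('X * g.1, 'X * g.2) = 'X^2 * infty g.
    by rewrite /infty /= !comp_polyM comp_polyX; ring.
  apply: leq_trans (size_polyMleq _ _) _; rewrite size_polyXn.
  by move: size_g; move: (size _) => m; clear; lia.
move=> j lt_j.
have -> : taylor (trunc_series s r.+1) ('X * g.1, 'X * g.2)
  = 'X * taylor (trunc_series s r.+1) g by rewrite /taylor /=; ring.
by rewrite coefXM; case: j lt_j => // j lt_j; rewrite vanish.
Qed.

Hypothesis s0_neq0 : s 0%N != 0.
Hypothesis two_neq0 : (2 : K) != 0.

(** If (n - 1) P and (n + 1) P both lie on the theta divisor, say
    (n - 1) P + Q ~ n infinity and (n + 1) P + R ~ (n + 2) infinity, then
    2 P + R + Q' ~ 4 infinity for the conjugate Q' of Q. A function with this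
    divisor is a polynomial of degree 2 in X, hence a multiple of X^2 because X
    is a local parameter at P. Its divisor is therefore 2 P + 2 P' - 4 infinity
    for the conjugate P' of P; so Q = P and n P ~ n infinity. *)
Lemma torsion_of_tau_eq0 n : (3 <= n)%N ->
  tau s n.-1 = 0 -> tau s n.+1 = 0 -> exists g, torsion_function n g.
Proof.
move=> n_ge3 /tau_eq0[gm [nzm sm vm]] /tau_eq0[gp [nzp sp vp]].
rewrite prednK in sm; last by lia.
pose T := n.+2; have [E S2] := trunc_series_sqr s_sqr T.
set S := trunc_series s T in S2.
have S0 : S`_0 = s 0%N by rewrite coef_poly.
have [|am gmE] := @polyXn_dvd _ (taylor S gm) n.-1.
  by move=> j lt_j; apply: vm => //; rewrite /T; lia.
have [|ap gpE] := @polyXn_dvd _ (taylor S gp) n.+1.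
  by move=> j lt_j; apply: vp => //; rewrite /T; lia.
pose h := fmul f gp (fconj gm).
have sh : (size (infty h) <= (n.+2 + n).+1)%N.
  by have [] := infty_mul f_monic size_f sp (size_infty_conj sm).
have hE : taylor S h = 'X^(n.+1) * (ap * taylor S (fconj gm))
                       - 'X^T * (E * gp.2 * (fconj gm).2).
  by rewrite (taylor_mul _ _ S2) gpE -mulrA.
have hcE : h.1 - h.2 * S = 'X^(n.-1) * (am * taylor S (fconj gp))
                           - 'X^T * (E * (fconj gp).2 * gm.2).
  rewrite mulrA -gmE [taylor S gm * _]mulrC -(taylor_mul _ _ S2).
  by rewrite /h /taylor /=; ring.
have h2 : h.2 = 0.
  apply/polyP => j; rewrite coef0; have [lt_j|le_j] := ltnP j n.-1.
    have p0 : (2 *: S)`_0 != 0 by rewrite coefZ S0 mulf_neq0.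
    apply: (mul_polyXn_eq0 p0) lt_j => {}j lt_j.
    have -> : 2 *: S * h.2 = taylor S h - (h.1 - h.2 * S).
      by rewrite /taylor -mul_polyC polyCMn; ring.
    rewrite hE hcE !coefB !coefXnM !ifT ?subrr //; rewrite /T; lia.
  have := leq_sizeP _ _ sh (j.*2 + 5)%N; rewrite coef_infty oddD odd_double /=.
  rewrite (_ : (_ + 5 < 5)%N = false); last by lia.
  by rewrite addnK doubleK => -> //; lia.
set c := h.1`_(n.+1).
have h1 : h.1 = c *: 'X^(n.+1).
  apply/polyP => j; rewrite coefZ coefXn; have [lt_j|lt_j|->] := ltngtP j n.+1.
  - rewrite mulr0; have -> : h.1 = taylor S h by rewrite /taylor h2 mul0r addr0.
    rewrite hE coefB !coefXnM lt_j ifT ?subrr //.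
    by rewrite /T; lia.
  - have := leq_sizeP _ _ sh j.*2; rewrite coef_infty odd_double doubleK mulr0.
    by move=> -> //; lia.
  - by rewrite mulr1.
have norm_conj : fnorm f (fconj gm) = fnorm f gm by rewrite /fnorm /= sqrrN.
have normE : fnorm f gm * fnorm f gp = c ^+ 2 *: 'X^((n.+1).*2).
  rewrite -norm_conj mulrC -fnormM -/h /fnorm h2 expr0n mul0r subr0 h1.
  by rewrite exprZn -exprM muln2.
have nm0 : fnorm f gm != 0 by rewrite fnorm_eq0.
have np0 : fnorm f gp != 0 by rewrite fnorm_eq0.
have c0 : c != 0.
  apply/eqP => c0; have /eqP := mulf_neq0 nm0 np0.
  by rewrite normE c0 expr0n scale0r.
have : fnorm f gm %| 'X^((n.+1).*2).
  by rewrite -(dvdpZr _ _ (expf_neq0 2 c0)) -normE dvdp_mulr.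
rewrite -['X]subr0 => /dvdp_exp_XsubCP[k _].
rewrite subr0 => /eqpP[[a b]] /= /andP[nza nzb] eqab.
have nmE : fnorm f gm = (b / a) *: 'X^k.
  by rewrite mulrC -scalerA -eqab scalerA mulVf ?scale1r.
have def_k : k = n.
  have skm : size (fnorm f gm) = k.+1.
    by rewrite nmE size_scale ?size_polyXn // mulf_neq0 ?invr_eq0.
  have le_km : (k <= n)%N by rewrite -ltnS -skm (size_fnorm f_monic size_f).
  have := congr1 (fun p : {poly K} => size p) normE.
  rewrite /= size_mul // size_scale ?expf_neq0 // size_polyXn skm.
  rewrite (size_fnorm f_monic size_f); move: sp.
  by move: (size (infty gp)) => m; lia.
exists gm; split=> //.
  by rewrite nmE def_k coefZ coefXn eqxx mulr1.
have tg0 : (taylor S (fconj gm))`_0 = gm.1`_0 - gm.2`_0 * s 0%N.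
  by rewrite coefD coef0M /= coefN S0 mulNr.
apply: contraNneq c0 => tg0'; rewrite /c.
have -> : h.1 = taylor S h by rewrite /taylor h2 mul0r addr0.
rewrite hE coefB !coefXnM ltnn subnn ifT; last by rewrite /T.
by rewrite coef0M tg0 tg0' mulr0 subr0.
Qed.

End Zeros.

(** * Quasi-periodic sequences *)

Section QuasiPeriod.
Variables (K : fieldType) (c : int -> K) (A B : K) (r : nat).
Hypotheses (A_neq0 : A != 0) (B_neq0 : B != 0) (AB : A ^+ r = B ^+ 2).
Hypothesis c_shift : forall n : int, c (n + r%:Z) = A ^ n * B * c n.

Lemma quasi_period_iter k (n : int) :
  c (n + (k * r)%:Z) = (A ^+ k) ^ n * B ^+ (k ^ 2) * c n.
Proof.
elim: k => [|k IHk]; first by rewrite mul0n addr0 exp1rz !mul1r.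
rewrite mulSn [(r + _)%N]addnC PoszD addrA c_shift IHk.
rewrite expfzDr // -exprnP mulnC exprM AB -exprM exprS expfzMl.
rewrite (_ : (k.+1 ^ 2 = 2 * k + 1 + k ^ 2)%N); last by lia.
by rewrite !exprD; ring.
Qed.

Hypotheses (c2 : c 2 != 0) (c3 : c 3 != 0).

Lemma quasi_period_periodic k :
  (forall n : int, c (n + (k * r)%:Z) = c n) <-> A ^+ k = 1 /\ B ^+ (k ^ 2) = 1.
Proof.
split=> [per | [Ak Bk] n]; last by rewrite quasi_period_iter Ak Bk exp1rz !mul1r.
have unit n : c n != 0 -> (A ^+ k) ^ n * B ^+ (k ^ 2) = 1.
  move=> cn; apply: (mulIf cn); rewrite mul1r -[in RHS]per.
  by rewrite quasi_period_iter.
have e2 := unit _ c2; have e3 := unit _ c3.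
have Ak : A ^+ k = 1.
  have : A ^+ k * ((A ^+ k) ^ 2 * B ^+ (k ^ 2)) = (A ^+ k) ^ 3 * B ^+ (k ^ 2).
    by rewrite mulrA -!exprnP -exprS.
  by rewrite e2 e3 mulr1.
by split=> //; move: e2; rewrite Ak exp1rz mul1r.
Qed.

Lemma quasi_period_is_period d : (0 < r)%N ->
  (forall t, (0 < t)%N -> (forall n : int, c (n + t%:Z) = c n) -> (r %| t)%N) ->
  least_pos (fun e => A ^+ e = 1 /\ B ^+ (e ^ 2) = 1) d -> is_period c (d * r).
Proof.
move=> r_gt0 dvd_per [d_gt0 /quasi_period_periodic per min_d]; split=> //.
  by rewrite muln_gt0 d_gt0.
move=> t t_gt0 per_t; have /dvdnP[k def_t] := dvd_per t t_gt0 per_t.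
rewrite def_t in t_gt0 per_t *; rewrite leq_pmul2r //; apply: min_d.
  by move: t_gt0; rewrite muln_gt0 => /andP[].
exact/quasi_period_periodic.
Qed.

End QuasiPeriod.

Lemma bin2D m n : 'C(m + n, 2) = ('C(m, 2) + 'C(n, 2) + m * n)%N.
Proof.
by elim: m => [|m IHm]; rewrite ?addn0 ?mul0n // addSn !binS !bin1 IHm; lia.
Qed.

Section Sequence.
Variables (K : fieldType) (f : {poly K}).
Hypotheses (f_monic : f \is monic) (size_f : size f = 6%N).
Variable s : nat -> K.
Hypothesis s_sqr : forall j, \sum_(i < j.+1) s i * s (j - i)%N = f`_j.
Hypothesis s0_neq0 : s 0%N != 0.
Hypothesis two_neq0 : (2 : K) != 0.

Lemma tau2 : tau s 2 = 1.
Proof.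
rewrite /tau /coef_det -(det1 _ 2); congr (\det _); apply/matrixP => i j.
rewrite !mxE /taylor /mono /pole.
by case: i j => [[|[|i]] ?] // [[|[|j]] ?] //=; rewrite mul0r addr0 !coefE.
Qed.

Variable w : K.
Hypothesis wE : w = 2 * s 0%N.

Variable c : int -> K.
Hypothesis cN : forall n, c (- n) = - c n.
Hypotheses (c0 : c 0 = 0) (c1 : c 1 = 0).
Hypothesis c_tau : forall n : nat, (2 <= n)%N -> c n * w = w ^+ 'C(n, 2) * tau s n.

Lemma w_neq0 : w != 0. Proof. by rewrite wE mulf_neq0. Qed.

Lemma c_eq0 (n : nat) : (2 <= n)%N -> (c n == 0) = (tau s n == 0).
Proof.
move=> n_ge2; have := c_tau n_ge2.
move/(congr1 (eq_op^~ 0)).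
by rewrite !mulf_eq0 (negPf w_neq0) orbF expf_eq0 (negPf w_neq0) andbF.
Qed.

(** The shift formula covers n >= 2, the reflection formula - r <= n <= 0, and
    the oddness of c carries the former over to n < - r. The compatibility
    A^r = B^2 comes from two reflections in a row, which return tau 2 to itself. *)
Lemma c_quasi_periodic r g : (0 < r)%N -> torsion_function f s r g ->
  exists A B, [/\ A != 0, B != 0, A ^+ r = B ^+ 2
    & forall n : int, c (n + r%:Z) = A ^ n * B * c n].
Proof.
move=> r_gt0 /(torsion_function_normalized f_monic size_f r_gt0).
case=> {}g [norm_g size_g lead_g conj_g r_ge5].
pose u0 := (-1) ^+ r / (g.1`_0 - g.2`_0 * s 0%N).
pose k0 := kappa s r.
have u0_neq0 : u0 != 0 by rewrite mulf_neq0 ?signr_eq0 ?invr_eq0.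
have w_neq0 := w_neq0.
have shift n : (2 <= n)%N -> tau s (r + n) = - k0 * u0 ^+ n * tau s n.
  by move=> n_ge2; apply: (tau_shift s_sqr f_monic size_f norm_g).
have reflect m k : (m + k = r)%N -> (2 <= m)%N -> (2 <= k)%N ->
    k0 * tau s k = (w * u0) ^+ k * tau s m.
  by move=> mk m2 k2; rewrite wE; apply: (tau_reflect s_sqr f_monic size_f norm_g).
clearbody u0 k0.
have k02 : k0 ^+ 2 = (w * u0) ^+ r.
  have r2 : (2 + (r - 2) = r)%N by lia.
  have e1 : k0 * tau s (r - 2) = (w * u0) ^+ (r - 2) * tau s 2 by apply: reflect; lia.
  have e2 : k0 * tau s 2 = (w * u0) ^+ 2 * tau s (r - 2) by apply: reflect; lia.
  move: e1 e2; rewrite tau2 !mulr1 => e1 e2.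
  by rewrite -[in RHS]r2 exprD -e1 expr2 {1}e2; ring.
have k0_neq0 : k0 != 0.
  apply/eqP => k00; have /eqP := expf_neq0 r (mulf_neq0 w_neq0 u0_neq0).
  by rewrite -k02 k00 expr0n.
have bin_r2 : ('C(r, 2) * 2 + r = r * r)%N.
  by elim: (r) => // m IHm; rewrite binS bin1; lia.
pose A := u0 * w ^+ r; pose B := - k0 * w ^+ 'C(r, 2).
have A_neq0 : A != 0 by rewrite mulf_neq0 ?expf_neq0.
have B_neq0 : B != 0 by rewrite mulf_neq0 ?expf_neq0 ?oppr_eq0.
have AB : A ^+ r = B ^+ 2.
  rewrite /A /B !exprMn sqrrN k02 exprMn -!exprM -bin_r2 exprD; ring.
have AE : A = u0 * w ^+ r by [].
have BE : B = - k0 * w ^+ 'C(r, 2) by [].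
clearbody A B.
have tau_r n : (r.-1 <= n <= r.+1)%N -> tau s n = 0.
  exact: (tau_torsion_eq0 f_monic size_f s_sqr norm_g size_g conj_g r_ge5).
have shiftN (n : nat) : c (n + r)%N = A ^+ n * B * c n.
  have [lt_n|le_n] := ltnP n 2.
    have -> : c n = 0 by case: n lt_n => [|[]].
    have : c (n + r)%N == 0 by rewrite c_eq0 ?tau_r //; clear -r_ge5 lt_n; lia.
    by move/eqP ->; rewrite mulr0.
  apply: (mulIf w_neq0); rewrite c_tau; last by clear -le_n; lia.
  rewrite -!mulrA c_tau // addnC shift // bin2D AE BE !exprD exprMn -exprM; ring.
have reflectN m k : (m + k = r)%N -> A ^+ m * c k = - B * c m.
  move=> mk; have [lt_m|le_m] := ltnP m 2.
    have -> : c m = 0 by case: m lt_m {mk} => [|[]].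
    have : c k == 0 by rewrite c_eq0 ?tau_r //; clear -r_ge5 lt_m mk; lia.
    by move/eqP ->; rewrite !mulr0.
  have [lt_k|le_k] := ltnP k 2.
    have -> : c k = 0 by case: k lt_k {mk} => [|[]].
    have : c m == 0 by rewrite c_eq0 ?tau_r //; clear -r_ge5 lt_k mk; lia.
    by move/eqP ->; rewrite !mulr0.
  apply: (mulIf w_neq0); rewrite -!mulrA !c_tau //.
  apply: (mulfI k0_neq0).
  have -> : k0 * (A ^+ m * (w ^+ 'C(k, 2) * tau s k)) =
     A ^+ m * w ^+ 'C(k, 2) * (k0 * tau s k) by ring.
  rewrite (reflect m k) //.
  have -> : k0 * (- B * (w ^+ 'C(m, 2) * tau s m)) =
     k0 ^+ 2 * w ^+ 'C(r, 2) * w ^+ 'C(m, 2) * tau s m by rewrite BE; ring.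
  have w_exp : w ^+ r * w ^+ 'C(r, 2) * w ^+ 'C(m, 2) =
      w ^+ (r * m) * w ^+ 'C(k, 2) * w ^+ k.
    rewrite -!exprD; congr (w ^+ _); rewrite -mk bin2D.
    have : ('C(m, 2) * 2 + m = m * m)%N; last by clear; lia.
    by elim: (m) => // q IHq; rewrite binS bin1; lia.
  have u_exp : u0 ^+ r = u0 ^+ m * u0 ^+ k by rewrite -exprD mk.
  have -> : k0 ^+ 2 * w ^+ 'C(r, 2) * w ^+ 'C(m, 2) * tau s m =
     u0 ^+ r * tau s m * (w ^+ r * w ^+ 'C(r, 2) * w ^+ 'C(m, 2)).
    by rewrite k02 exprMn; ring.
  by rewrite w_exp u_exp AE !exprMn -exprM; ring.
exists A, B; split=> // n; case: (intP n) => [|{}n|{}n].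
- by rewrite (shiftN 0).
- by rewrite (shiftN n.+1).
have [le_nr|lt_rn] := leqP n.+1 r.
  have mk : (n.+1 + (r - n.+1) = r)%N by rewrite subnKC.
  have -> : - n.+1%:Z + r%:Z = (r - n.+1)%N%:Z by lia.
  apply: (mulfI (expf_neq0 n.+1 A_neq0)); rewrite (reflectN _ _ mk) cN.
  by rewrite -exprnN; field; rewrite ?expf_neq0.
have -> : - n.+1%:Z + r%:Z = - (n.+1 - r)%N%:Z by lia.
have def_n : (n.+1 - r + r = n.+1)%N by rewrite subnK // ltnW.
rewrite !cN -[in c n.+1]def_n shiftN -exprnN -[in A ^+ n.+1]def_n exprD AB.
by field; rewrite B_neq0 !expf_neq0.
Qed.

End Sequence.

(** * Cantor's division polynomials as Taylor determinants *)

Section CantorHankel.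
Variables (K : fieldType) (s : nat -> K).

(** The rows X^i clear the first k columns of the other rows, and reversing the
    order of the multiples of Y turns the rest into a Hankel matrix. *)
Lemma coef_dets_hankel T k N : (k + N <= T)%N -> (N <= k.+1)%N ->
  coef_dets ([seq 'X^i | i <- iota 0 k] ++
             [seq 'X^i * trunc_series s T | i <- rev (iota 0 N)])
  = \det (\matrix_(i < N, j < N) s (k.+1 - N + i + j)%N).
Proof.
move=> le_T le_N; rewrite /coef_dets size_cat !size_map size_rev !size_iota.
rewrite coef_det_lblock => [|i j lt_i /andP[le_j lt_j]]; last first.
  rewrite nth_cat size_map size_iota lt_i (nth_map 0%N) ?size_iota //.
  by rewrite nth_iota // coefXn gtn_eqF // (leq_trans lt_i).
rewrite -[RHS]mul1r; congr (_ * _).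
  rewrite /coef_det -[RHS](det1 _ k); congr (\det _); apply/matrixP => i j.
  rewrite !mxE nth_cat size_map size_iota ltn_ord (nth_map 0%N) ?size_iota //.
  by rewrite nth_iota // coefXn eq_sym.
congr (\det _); apply/matrixP => i j; rewrite !mxE nth_cat size_map size_iota.
rewrite ifF; last by rewrite ltnNge leq_addr.
rewrite addKn (nth_map 0%N) ?size_rev ?size_iota //=.
rewrite nth_rev ?size_iota // nth_iota; last by move: (ltn_ord i); lia.
rewrite add0n coefXnM ifF; last by move: (ltn_ord i); lia.
rewrite coef_poly ifT; last by move: (ltn_ord i) (ltn_ord j); lia.
by congr s; move: (ltn_ord i) (ltn_ord j); lia.
Qed.

Let rows T m := [seq taylor (trunc_series s T) (mono K (pole i)) | i <- iota 0 m].
Let Xrows k : seq {poly K} := [seq 'X^i | i <- iota 0 k].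
Let Yrows T N : seq {poly K} := [seq 'X^i * trunc_series s T | i <- rev (iota 0 N)].

Lemma tau_rows n : tau s n = coef_dets (rows n n).
Proof.
rewrite /coef_dets size_map size_iota; apply: eq_coef_det => i j lt_i lt_j.
by rewrite (nth_map 0%N) ?size_iota // nth_iota.
Qed.

Lemma Yrows_recr T N : Yrows T N.+1 = 'X^N * trunc_series s T :: Yrows T N.
Proof. by rewrite /Yrows -addn1 iotaD rev_cat. Qed.

Lemma Xrows_recr k : Xrows k.+1 = rcons (Xrows k) 'X^k.
Proof. by rewrite /Xrows -addn1 iotaD map_cat cats1. Qed.

Lemma taylor_mono_even S k : taylor S (mono K k.*2) = 'X^k.
Proof. by rewrite /taylor /mono odd_double doubleK /= mul0r addr0. Qed.

Lemma taylor_mono_odd S k : taylor S (mono K (k.*2 + 5)) = 'X^k * S.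
Proof. by rewrite /taylor /mono oddD odd_double addnK doubleK /= add0r. Qed.

(** In the step from N to N + 1 both new rows move past the N old multiples of Y,
    without a change of sign. *)
Lemma sort_rows_even T N post :
  coef_dets (rows T N.*2.+2 ++ post) =
  coef_dets (Xrows N.+2 ++ Yrows T N ++ post).
Proof.
elim: N post => [|N IHN] post.
  by congr (coef_dets (_ :: _ :: post));
    [apply: (taylor_mono_even _ 0) | apply: (taylor_mono_even _ 1)].
have -> : rows T N.+1.*2.+2 = rows T N.*2.+2 ++ [:: 'X^(N.+2); 'X^N * trunc_series s T].
  rewrite /rows doubleS -addn2 iotaD map_cat /= /pole !add0n /=.
  by rewrite -[in RHS](taylor_mono_even (trunc_series s T) N.+2)
     -taylor_mono_odd (addnC N.*2 5).
rewrite -catA IHN (Xrows_recr N.+2) Yrows_recr cat_rcons.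
by rewrite -[RHS]/(coef_dets (Xrows N.+2 ++ 'X^(N.+2) :: 'X^N * trunc_series s T
  :: Yrows T N ++ post)) coef_dets_move2.
Qed.

(** Here the new power of X also moves past the new multiple of Y, which gives a
    sign in every step. *)
Lemma sort_rows_odd T N post :
  coef_dets (rows T N.*2.+3 ++ post) =
  (-1) ^+ N * coef_dets (Xrows N.+3 ++ Yrows T N ++ post).
Proof.
elim: N post => [|N IHN] post.
  rewrite mul1r; by congr (coef_dets (_ :: _ :: _ :: post));
    [apply: (taylor_mono_even _ 0) | apply: (taylor_mono_even _ 1)
    | apply: (taylor_mono_even _ 2)].
have -> : rows T N.+1.*2.+3 = rows T N.*2.+3 ++ [:: 'X^N * trunc_series s T; 'X^(N.+3)].
  rewrite /rows doubleS -addn2 iotaD map_cat /= /pole !add0n /=.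
  by rewrite -taylor_mono_odd -[in RHS](taylor_mono_even (trunc_series s T) N.+3)
     (addnC N.*2 5) !doubleS.
rewrite -catA IHN (Xrows_recr N.+3) Yrows_recr cat_rcons.
rewrite -[in RHS]/(coef_dets (Xrows N.+3 ++ 'X^(N.+3) :: 'X^N * trunc_series s T
  :: Yrows T N ++ post)) coef_dets_swap coef_dets_move2.
by rewrite [(-1) ^+ N.+1]exprS mulN1r mulrN mulNr opprK.
Qed.

Lemma tau_even N :
  tau s N.*2.+2 = \det (\matrix_(i < N, j < N) s (3 + i + j)%N).
Proof.
rewrite tau_rows -[rows _ _]cats0 sort_rows_even cats0 coef_dets_hankel; [|lia..].
by congr (\det _); apply/matrixP => i j; rewrite !mxE; congr s; lia.
Qed.

Lemma tau_odd N :
  tau s N.*2.+3 = (-1) ^+ N * \det (\matrix_(i < N, j < N) s (4 + i + j)%N).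
Proof.
rewrite tau_rows -[rows _ _]cats0 sort_rows_odd cats0 coef_dets_hankel; [|lia..].
by congr (_ * \det _); apply/matrixP => i j; rewrite !mxE; congr s; lia.
Qed.

End CantorHankel.

Section CantorPsi.
Variables (K : fieldType) (F : {poly K}) (x y : K).
Hypotheses (two_neq0 : (2 : K) != 0) (y_neq0 : y != 0) (yF : y ^+ 2 = F.[x]).

Let w : K := 2 * y.
Let f : {poly K} := F \Po ('X + x%:P).

(** Taylor coefficients of Y at (x, y) in the local parameter t = X - x. Cantor's
    series is - Y in the parameter z = - t, whence the signs. *)
Definition Y_series j : K :=
  if j is 0 then y else - (-1) ^+ j * ((cantor_P F j).[x] * w / w ^+ (2 * j)).

Lemma coef_comp_polyNX (p : {poly K}) j : (p \Po - 'X)`_j = (-1) ^+ j * p`_j.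
Proof.
elim/poly_ind: p j => [|p c IHp] [|j].
- by rewrite comp_poly0 coef0 mulr0.
- by rewrite comp_poly0 coef0 mulr0.
- by rewrite comp_poly_MXaddC !coefD !coefC mulrN coefN !coefMX oppr0 mul1r.
rewrite comp_poly_MXaddC !coefD !coefC mulrN coefN !coefMX IHp /= !addr0.
by rewrite exprS mulN1r mulNr.
Qed.

Lemma horner_shift_poly j : ((shift_poly F)`_j).[x] = (-1) ^+ j * f`_j.
Proof.
rewrite -coef_comp_polyNX -[LHS]/(horner_eval x _) -coef_map.
congr (_`_ _); rewrite /shift_poly map_comp_poly rmorphB /= map_polyX map_polyC /=.
rewrite -map_poly_comp /f -comp_polyA comp_polyD comp_polyX comp_polyC addrC.
rewrite /horner_eval hornerX; congr (_ \Po _).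
by rewrite map_poly_id // => c _ /=; rewrite /horner_eval hornerC.
Qed.

Lemma Y_series_sqr j : \sum_(i < j.+1) Y_series i * Y_series (j - i) = f`_j.
Proof.
pose s' i := - ((-1) ^+ i * Y_series i).
have [] := cantor_PP (s := s') two_neq0 y_neq0 yF.
  by rewrite /s' mul1r.
move=> _ conv; have {conv} := conv _ j; rewrite horner_shift_poly.
have -> : \sum_(i < j.+1) s' i * s' (j - i)%N =
   (-1) ^+ j * \sum_(i < j.+1) Y_series i * Y_series (j - i)%N.
  rewrite mulr_sumr; apply: eq_bigr => i _; rewrite /s' mulrNN.
  have -> : (-1) ^+ j = (-1) ^+ i * (-1) ^+ (j - i) :> K.
    by rewrite -exprD subnKC // -ltnS.
  ring.
move=> conv; apply: (@mulfI _ ((-1) ^+ j)); first by rewrite signr_eq0.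
apply: conv => i; rewrite /s' /Y_series mulNr mulrN opprK mulrA -expr2.
by rewrite sqrr_sign mul1r.
Qed.

Let w_neq0 : w != 0. Proof. exact: mulf_neq0. Qed.

Lemma cantor_P_Y_series k i j : (cantor_P F (k.+1 + i + j)).[x] =
  (-1) ^+ k * w ^+ (2 * k + 1) * (- w ^+ 2) ^+ i * (- w ^+ 2) ^+ j
  * Y_series (k.+1 + i + j).
Proof.
rewrite /Y_series !addSn -!addSn; move: (cantor_P _ _).[x] => p.
rewrite mulnDr mulnDr (_ : 2 * k.+1 = 2 * k + 1 + 1)%N; last by lia.
have -> : w ^+ (2 * k + 1 + 1 + 2 * i + 2 * j) =
    w ^+ (2 * k + 1) * w * w ^+ (2 * i) * w ^+ (2 * j).
  by rewrite -exprSr -!exprD addn1.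
have -> : (-1) ^+ (k.+1 + i + j) = - ((-1) ^+ k * (-1) ^+ i * (-1) ^+ j) :> K.
  by rewrite -!exprD !addSn exprS mulN1r.
rewrite ![(- w ^+ 2) ^+ _]exprNn -!exprM.
have := sqrr_sign K k; have := sqrr_sign K i; have := sqrr_sign K j.
move: ((-1) ^+ k) ((-1) ^+ i) ((-1) ^+ j) => a b c c2 b2 a2.
rewrite [RHS](_ : _ = a ^+ 2 * b ^+ 2 * c ^+ 2 * p); last first.
  by field; rewrite w_neq0 !expf_neq0.
by rewrite a2 b2 c2 !mul1r.
Qed.

Lemma det_cantor_P k N :
  (\det (\matrix_(i < N, j < N) cantor_P F (k.+1 + i + j))).[x] =
  ((-1) ^+ k * w ^+ (2 * k + 1)) ^+ N * w ^+ (4 * 'C(N, 2))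
  * \det (\matrix_(i < N, j < N) Y_series (k.+1 + i + j)).
Proof.
rewrite -[LHS]/(horner_eval x _) -det_map_mx.
pose c : K := (-1) ^+ k * w ^+ (2 * k + 1).
have -> : map_mx (horner_eval x) (\matrix_(i < N, j < N) cantor_P F (k.+1 + i + j))
  = \matrix_(i < N, j < N) (c * (- w ^+ 2) ^+ i * (- w ^+ 2) ^+ j
                            * Y_series (k.+1 + i + j)).
  by apply/matrixP => i j; rewrite !mxE -cantor_P_Y_series.
rewrite (@det_scale _ N c (fun i => (- w ^+ 2) ^+ i) (fun i j => Y_series (k.+1 + i + j))).
congr (_ * _ * _); rewrite prodrXr -(big_mkord xpredT id) bin2_sum -exprM mulnC exprM.
by rewrite sqrrN -!exprM; congr (w ^+ _); lia.
Qed.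

(** Scaling rows and columns by powers of - w^2 turns Cantor's Hankel matrix into
    that of the Taylor coefficients. The factor 4 F of the odd polynomials is w^2
    and makes the exponent of w uniform in the parity of n; the signs cancel those
    of [tau_odd]. *)
Lemma psi_tau n : (2 <= n)%N ->
  (psi_nat F n).[x] * w = w ^+ 'C(n, 2) * tau Y_series n.
Proof.
case: n => [|[|m]] // _; rewrite /psi_nat; set N := m./2.
have bin2E q : ('C(q, 2) * 2 + q = q * q)%N.
  by elim: q => // q IHq; rewrite binS bin1; lia.
case: ifP => odd_m.
  have -> : m.+2 = N.*2.+3 by rewrite /N; lia.
  rewrite tau_odd hornerM hornerZ det_cantor_P -yF.
  have -> : 'C(N.*2.+3, 2) = (7 * N + 4 * 'C(N, 2) + 3)%N.
    by have := bin2E N; have := bin2E N.*2.+3; lia.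
  have -> : (-1) ^+ 3 * w ^+ (2 * 3 + 1) = - w ^+ 7 by ring.
  have -> : w ^+ (7 * N + 4 * 'C(N, 2) + 3) = (w ^+ 7) ^+ N * w ^+ (4 * 'C(N, 2)) * w ^+ 3.
    by rewrite -exprM -!exprD.
  rewrite [(- w ^+ 7) ^+ N]exprNn.
  rewrite (_ : 4 * y ^+ 2 = w ^+ 2); last by rewrite /w exprMn -natrX.
  by ring.
have -> : m.+2 = N.*2.+2 by rewrite /N; lia.
rewrite tau_even det_cantor_P.
have -> : 'C(N.*2.+2, 2) = (5 * N + 4 * 'C(N, 2) + 1)%N.
  by have := bin2E N; have := bin2E N.*2.+2; lia.
have -> : (-1) ^+ 2 * w ^+ (2 * 2 + 1) = w ^+ 5 by ring.
have -> : w ^+ (5 * N + 4 * 'C(N, 2) + 1) = (w ^+ 5) ^+ N * w ^+ (4 * 'C(N, 2)) * w.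
  by rewrite -exprM -exprD addn1 exprSr.
by ring.
Qed.

End CantorPsi.

(** * Divisors on the curve *)

Section Divisors.
Variables (K : closedFieldType) (f : {poly K}).
Hypotheses (f_monic : f \is monic) (size_f : size f = 6%N).
Implicit Types (g h : func K) (Q : affine_pt f).

Local Notation R := (coord_ring f).
Implicit Types p q u v : R.

Definition of_func g : R := in_qpoly _ (g.1%:P + g.2%:P * 'X).
Definition to_func q : func K :=
  ((q : {poly {poly K}})`_0, (q : {poly {poly K}})`_1).

Lemma size_modulus : size (mk_monic ('X^2 - f%:P)) = 3%N.
Proof.
rewrite /mk_monic size_XnsubC // ifT ?size_XnsubC //=.
exact: monicXnsubC.
Qed.

Lemma modulusE : mk_monic ('X^2 - f%:P) = 'X^2 - f%:P.
Proof. by rewrite /mk_monic size_XnsubC // ifT //= monicXnsubC. Qed.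

Lemma to_funcK q : of_func (to_func q) = q.
Proof.
apply: val_inj; rewrite /of_func /to_func /=.
have sq : (size (q : {poly {poly K}}) <= 2)%N.
  by rewrite -ltnS; apply: leq_trans (size_mk_monic q) _; rewrite size_modulus.
have -> : ((q : {poly {poly K}})`_0)%:P + ((q : {poly {poly K}})`_1)%:P * 'X
    = q :> {poly {poly K}}.
  apply/polyP => i; rewrite coefD coefC coefCM coefX.
  case: i => [|[|i]]; rewrite ?mulr0 ?mulr1 ?addr0 ?add0r //=.
  by rewrite nth_default // (leq_trans sq).
exact/in_qpoly_small/size_mk_monic.
Qed.

Lemma of_funcK g : to_func (of_func g) = g.
Proof.
case: g => a b; rewrite /to_func /of_func in_qpoly_small /=.
  rewrite !coefD !coefC !coefCM !coefX /=.
  by rewrite mulr0 mulr1 addr0 add0r.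
rewrite size_modulus; apply: leq_ltn_trans (size_polyD _ _) _.
rewrite gtn_max size_polyC; apply/andP; split; first by case: eqP.
rewrite mul_polyC; apply: leq_ltn_trans (size_scale_leq _ _) _.
by rewrite size_polyX.
Qed.

Lemma of_funcM g h : of_func (fmul f g h) = of_func g * of_func h.
Proof.
rewrite /of_func -in_qpolyM /fmul /=.
have -> : (g.1%:P + g.2%:P * 'X) * (h.1%:P + h.2%:P * 'X) =
    (g.1 * h.1 + g.2 * h.2 * f)%:P + (g.1 * h.2 + g.2 * h.1)%:P * 'X
    + (g.2 * h.2)%:P * ('X^2 - f%:P).
  by rewrite !polyCD !polyCM; ring.
rewrite [RHS]in_qpolyD [X in _ = _ + X]in_qpolyM.
rewrite [X in _ = _ + _ * X](_ : _ = 0) ?mulr0 ?addr0 //.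
by apply: val_inj; rewrite /= modulusE Pdiv.RingMonic.rmodpp // monicXnsubC.
Qed.

Lemma of_funcD g h : of_func (g + h) = of_func g + of_func h.
Proof.
rewrite /of_func -in_qpolyD; congr in_qpoly.
by rewrite /= !polyCD; ring.
Qed.

Lemma to_funcM p q : to_func (p * q) = fmul f (to_func p) (to_func q).
Proof. by rewrite -[RHS]of_funcK of_funcM !to_funcK. Qed.

Lemma to_funcD p q : to_func (p + q) = to_func p + to_func q.
Proof. by rewrite -[RHS]of_funcK of_funcD !to_funcK. Qed.

Lemma to_func0 : to_func 0 = 0.
Proof. by rewrite /to_func /= !coef0. Qed.

Lemma to_func_eq0 q : (to_func q == 0) = (q == 0).
Proof.
apply/eqP/eqP => [q0|->]; last exact: to_func0.
by rewrite -[q]to_funcK q0 -to_func0 to_funcK.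
Qed.

Definition of_poly (a : {poly K}) : R := of_func (a, 0).

Lemma of_polyM a b : of_poly (a * b) = of_poly a * of_poly b.
Proof. by rewrite -of_funcM /fmul /= !mul0r !mulr0 !addr0. Qed.

Lemma of_polyD a b : of_poly (a + b) = of_poly a + of_poly b.
Proof. by rewrite -of_funcD /of_poly; congr (of_func (_, _)); rewrite /= addr0. Qed.

Lemma of_poly1 : of_poly 1 = 1.
Proof. by rewrite /of_poly /of_func /= mul0r addr0 in_qpoly1. Qed.

Lemma of_polyX n (a : {poly K}) : of_poly (a ^+ n) = of_poly a ^+ n.
Proof. by elim: n => [|n IHn]; rewrite ?of_poly1 // !exprS of_polyM IHn. Qed.

Lemma coord_constE c : coord_const f c = of_poly c%:P.
Proof. by rewrite /of_poly /of_func /= mul0r addr0. Qed.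

Lemma coord_XE : coord_X f = of_poly 'X.
Proof. by rewrite /of_poly /of_func /= mul0r addr0. Qed.

Lemma coord_YE : coord_Y f = of_func (0, 1).
Proof. by rewrite /of_func /= add0r mul1r. Qed.

Lemma of_polyB a b : of_poly (a - b) = of_poly a - of_poly b.
Proof. by apply/eqP; rewrite eq_sym subr_eq -of_polyD subrK. Qed.

Lemma of_funcE g : of_func g = of_poly g.1 + of_poly g.2 * coord_Y f.
Proof.
rewrite coord_YE -of_funcM -of_funcD /fmul /=; case: g => a b; congr of_func.
by congr (_, _) => /=; rewrite !(mul0r, mulr0, mulr1, addr0, add0r).
Qed.

Definition conj q : R := of_func (fconj (to_func q)).
Definition norm q : {poly K} := fnorm f (to_func q).

Lemma mul_conj q : q * conj q = of_poly (norm q).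
Proof. by rewrite -{1}[q]to_funcK -of_funcM fmul_conj. Qed.

Lemma normM p q : norm (p * q) = norm p * norm q.
Proof. by rewrite /norm to_funcM fnormM. Qed.

Lemma norm_eq0 q : (norm q == 0) = (q == 0).
Proof. by rewrite /norm fnorm_eq0 // to_func_eq0. Qed.

Lemma coord_mulf_eq0 p q : (p * q == 0) = (p == 0) || (q == 0).
Proof. by rewrite -!norm_eq0 normM mulf_eq0. Qed.

Lemma coord_mulfI p : p != 0 -> injective (fun q => p * q).
Proof.
move=> nzp q q' /eqP; rewrite -subr_eq0 -mulrBr coord_mulf_eq0 (negPf nzp) subr_eq0.
by move/eqP.
Qed.

Lemma conj_eq0 q : (conj q == 0) = (q == 0).
Proof.
apply/eqP/eqP => [q0|->].
  apply/eqP; rewrite -norm_eq0 -[norm q]/((norm q, 0 : {poly K}).1).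
  by rewrite -(of_funcK (_, 0)) -/(of_poly _) -mul_conj q0 mulr0 to_func0.
have conj0 : fconj (to_func 0) = to_func 0 by rewrite to_func0 /fconj /= oppr0.
by rewrite /conj conj0 to_funcK.
Qed.

Definition ev Q q : K :=
  (to_func q).1.[(val Q).1] + (to_func q).2.[(val Q).1] * (val Q).2.

Lemma evD Q p q : ev Q (p + q) = ev Q p + ev Q q.
Proof. by rewrite /ev to_funcD /= !hornerD; ring. Qed.

Lemma evM Q p q : ev Q (p * q) = ev Q p * ev Q q.
Proof.
rewrite /ev to_funcM /= !hornerD !hornerM -(eqP (valP Q)); ring.
Qed.

Lemma ev_poly Q a : ev Q (of_poly a) = a.[(val Q).1].
Proof. by rewrite /ev of_funcK /= horner0 mul0r addr0. Qed.

Lemma ev1 Q : ev Q 1 = 1.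
Proof. by rewrite -of_poly1 ev_poly hornerC. Qed.

Lemma ev0 Q : ev Q 0 = 0.
Proof. by rewrite /ev to_func0 /= horner0 mul0r addr0. Qed.

Lemma evN Q q : ev Q (- q) = - ev Q q.
Proof. by apply/eqP; rewrite -addr_eq0 -evD addNr ev0. Qed.

Lemma evX Q q n : ev Q (q ^+ n) = ev Q q ^+ n.
Proof. by elim: n => [|n IHn]; rewrite ?ev1 // !exprS evM IHn. Qed.

Lemma ev_Y Q : ev Q (coord_Y f) = (val Q).2.
Proof. by rewrite coord_YE /ev of_funcK /= horner0 hornerC mul1r add0r. Qed.

Lemma ev_conj Q Q' q : (val Q').1 = (val Q).1 -> (val Q').2 = - (val Q).2 ->
  ev Q (conj q) = ev Q' q.
Proof. by move=> e1 e2; rewrite /ev of_funcK /= e1 e2 hornerN; ring. Qed.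

Let dX Q : R := coord_X f - coord_const f (val Q).1.
Let dY Q : R := coord_Y f - coord_const f (val Q).2.

Lemma dX_E Q : dX Q = of_poly ('X - (val Q).1%:P).
Proof. by rewrite /dX coord_XE coord_constE of_polyB. Qed.

Lemma ev_dX Q : ev Q (dX Q) = 0.
Proof. by rewrite dX_E ev_poly !hornerE subrr. Qed.

Lemma ev_dY Q : ev Q (dY Q) = 0.
Proof. by rewrite /dY evD evN ev_Y coord_constE ev_poly hornerC subrr. Qed.

Lemma ev_eq0 Q q : ev Q q = 0 -> exists a b, q = a * dX Q + b * dY Q.
Proof.
move=> q0; set A := (to_func q).1; set B := (to_func q).2.
have /factor_theorem[D defD] : root (A + (val Q).2 *: B) (val Q).1.
  by rewrite /root hornerD hornerZ mulrC -/(ev Q q) q0.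
exists (of_poly D), (of_poly B).
rewrite dX_E -of_polyM -defD of_polyD -{1}[q]to_funcK of_funcE -/A -/B.
rewrite /dY coord_constE -mul_polyC of_polyM; ring.
Qed.

(** * Powers of the maximal ideal of a point *)

Local Notation ideal := (@in_max_ideal_pow K f).

Lemma ideal_add Q n p q : ideal Q n p -> ideal Q n q -> ideal Q n (p + q).
Proof.
move=> [u ->] [v ->]; exists (fun i => u i + v i); rewrite -big_split /=.
by apply: eq_bigr => i _; rewrite !mulrDl.
Qed.

Lemma ideal_mul Q n p q : ideal Q n q -> ideal Q n (p * q).
Proof.
move=> [u ->]; exists (fun i => p * u i); rewrite mulr_sumr.
by apply: eq_bigr => i _; rewrite !mulrA.
Qed.

Lemma ideal_gen Q n i : (i <= n)%N -> ideal Q n (dX Q ^+ i * dY Q ^+ (n - i)).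
Proof.
move=> le_in; exists (fun j => (j == i :> nat)%:R).
rewrite (bigD1 (inord i)) //= inordK // eqxx mul1r big1 ?addr0 // => j.
by rewrite -val_eqE /= inordK // => /negPf ->; rewrite !mul0r.
Qed.

Lemma ideal0 Q q : ideal Q 0 q.
Proof. by exists (fun=> q); rewrite big_ord1 /= !mulr1. Qed.

Lemma ideal_succ Q n p q : ev Q p = 0 -> ideal Q n q -> ideal Q n.+1 (p * q).
Proof.
move=> /ev_eq0[a [b ->]] [u ->]; rewrite mulr_sumr.
elim/big_ind: _ => [||i _].
- by rewrite -(mul0r (dX Q ^+ 0 * dY Q ^+ n.+1)); apply/ideal_mul/(@ideal_gen Q n.+1 0).
- exact: ideal_add.
have le_i : (i <= n)%N by rewrite -ltnS.
have -> : (a * dX Q + b * dY Q) * (u i * dX Q ^+ i * dY Q ^+ (n - i)) =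
   a * u i * (dX Q ^+ i.+1 * dY Q ^+ (n.+1 - i.+1))
   + b * u i * (dX Q ^+ i * dY Q ^+ (n.+1 - i)).
  by rewrite subSS subSn // !exprS; ring.
by apply: ideal_add; apply/ideal_mul/ideal_gen; rewrite // ltnW.
Qed.

Lemma ideal_exp Q n q : ev Q q = 0 -> ideal Q n (q ^+ n).
Proof.
by move=> q0; elim: n => [|n IHn]; [apply: ideal0 | rewrite exprS; apply: ideal_succ].
Qed.

Lemma ideal_ev Q n q : ideal Q n.+1 q -> ev Q q = 0.
Proof.
move=> [u ->]; rewrite (big_morph _ (evD Q) (ev0 Q)) big1 // => i _.
rewrite !evM !evX -/(dX Q) -/(dY Q) ev_dX ev_dY -mulrA -exprD.
by rewrite subnKC ?expr0n ?mulr0 // -ltnS.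
Qed.

(** A function that does not vanish at Q is invertible modulo each power of the
    ideal: if e is its value, then e^n - (e - w)^n is a multiple of w. *)
Lemma ideal_unit Q n w q : ev Q w != 0 -> ideal Q n (w * q) -> ideal Q n q.
Proof.
set e := ev Q w => e0 wq; pose c := of_poly e%:P; pose z := c - w.
have z0 : ev Q z = 0 by rewrite evD evN ev_poly hornerC subrr.
have [t defw] : exists t, c ^+ n = z ^+ n + t * w.
  exists (\sum_(i < n) c ^+ (n.-1 - i) * z ^+ i).
  by rewrite -[LHS](subrK (z ^+ n)) subrXX /z; ring.
have -> : q = of_poly ((e ^- n)%:P) * (c ^+ n * q).
  rewrite mulrA -of_polyX -of_polyM -polyC_exp -polyCM.
  by rewrite mulVf ?expf_neq0 // of_poly1 mul1r.
apply: ideal_mul; rewrite defw mulrDl -mulrA; apply: ideal_add; last exact: ideal_mul.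
by rewrite mulrC; apply/ideal_mul/ideal_exp.
Qed.

End Divisors.
(** * Orders of vanishing *)

Section Principal.
Variables (K : closedFieldType) (f : {poly K}).
Hypotheses (f_monic : f \is monic) (size_f : size f = 6%N).
Hypothesis two_neq0 : (2 : K) != 0.
Hypothesis f_sep : forall xi, f.[xi] = 0 -> f^`().[xi] != 0.
Implicit Types (g h : func K) (Q : affine_pt f).

Local Notation R := (coord_ring f).
Implicit Types p q u v : R.
Local Notation dX Q := (coord_X f - coord_const f (val Q).1).
Local Notation dY Q := (coord_Y f - coord_const f (val Q).2).

Let mulfI := coord_mulfI f_monic size_f.

Lemma coord_Y_sqr : coord_Y f ^+ 2 = of_poly f f.
Proof.
rewrite coord_YE expr2 -of_funcM /fmul /=; congr of_func.
by rewrite !(mul0r, mulr0, mul1r, mulr1, addr0, add0r).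
Qed.

Lemma dX_neq0 Q : dX Q != 0.
Proof.
rewrite coord_XE coord_constE -of_polyB -(norm_eq0 f_monic size_f) /norm of_funcK.
by rewrite /fnorm /= expr0n mul0r subr0 expf_eq0 /= polyXsubC_eq0.
Qed.

Lemma dX_parameter Q : (val Q).2 != 0 -> [/\ dX Q != 0, ev Q (dX Q) = 0,
  ev Q (coord_Y f + coord_const f (val Q).2) != 0
  & exists b, (coord_Y f + coord_const f (val Q).2) * dY Q = dX Q * b].
Proof.
move=> y0; split; first exact: dX_neq0.
- exact: ev_dX.
- rewrite evD ev_Y coord_constE ev_poly hornerC -mulr2n -mulr_natl.
  by rewrite mulf_neq0.
have /factor_theorem[D defD] : root (f - f.[(val Q).1]%:P) (val Q).1.
  by rewrite /root !hornerE subrr.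
exists (of_poly f D); rewrite mulrC -subr_sqr coord_Y_sqr.
rewrite [RHS]mulrC coord_XE !coord_constE -[of_poly f 'X - _]of_polyB -of_polyM -defD.
by rewrite of_polyB -(eqP (valP Q)) -of_polyX polyC_exp.
Qed.

(** The maximal ideal of Q is locally generated by one element t: by X - x_Q if
    y_Q != 0, because (Y + y_Q) (Y - y_Q) = f(X) - f(x_Q); and by Y if
    y_Q = 0, because Y^2 = f(X) has a simple zero at X = x_Q. *)
Lemma local_parameter Q : exists t w, [/\ t != 0, ev Q t = 0, ev Q w != 0,
    exists a, w * dX Q = t * a & exists b, w * dY Q = t * b].
Proof.
have YE := eqP (valP Q).
have [y0|y0] := eqVneq (val Q).2 0.
  have fx0 : f.[(val Q).1] = 0 by rewrite -YE y0 expr0n.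
  have /factor_theorem[D defD] : root f (val Q).1 by rewrite /root fx0.
  exists (coord_Y f), (of_poly f D); split.
  - apply/eqP => Y0; have := coord_Y_sqr; rewrite Y0 expr0n /=.
    move/(congr1 (fun q => norm q)); rewrite /norm /of_poly of_funcK to_func0 => /eqP.
    rewrite eq_sym /fnorm /= !expr0n !mul0r !subr0 expf_eq0 /=.
    by rewrite -size_poly_eq0 size_f.
  - by rewrite ev_Y.
  - rewrite ev_poly; have := f_sep fx0; rewrite {1}defD derivM derivXsubC mulr1.
    by rewrite hornerD hornerM hornerXsubC subrr mulr0 add0r.
  - exists (coord_Y f); rewrite -expr2 coord_Y_sqr coord_XE coord_constE.
    by rewrite -of_polyB -of_polyM -defD.
  exists (of_poly f D); rewrite y0 mulrC coord_constE.
  by rewrite (_ : of_poly f 0%:P = 0) ?subr0 // -[X in _ = X]to_funcK to_func0.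
have [nzt t0 w0 eY] := dX_parameter y0.
by exists (dX Q), (coord_Y f + coord_const f (val Q).2); split=> //;
  exists (coord_Y f + coord_const f (val Q).2); rewrite mulrC.
Qed.

Lemma ideal_local Q t w a b n q :
    w * dX Q = t * a -> w * dY Q = t * b -> in_max_ideal_pow Q n q ->
  exists u, w ^+ n * q = t ^+ n * u.
Proof.
move=> eX eY [u ->]; exists (\sum_(i < n.+1) u i * a ^+ i * b ^+ (n - i)).
rewrite !mulr_sumr; apply: eq_bigr => i _.
have le_i : (i <= n)%N by rewrite -ltnS.
have expE (z : R) : z ^+ n = z ^+ i * z ^+ (n - i) by rewrite -exprD subnKC.
transitivity (u i * (w * dX Q) ^+ i * (w * dY Q) ^+ (n - i)).
  by rewrite expE !exprMn; ring.
by rewrite eX eY (expE t) !exprMn; ring.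
Qed.

Lemma vanishing_order_local Q t w a b n q :
    ev Q t = 0 -> ev Q w != 0 -> w * dX Q = t * a -> w * dY Q = t * b ->
    vanishing_order Q q n ->
  exists w' u, [/\ ev Q w' != 0, ev Q u != 0 & w' * q = t ^+ n * u].
Proof.
move=> t0 w0 eX eY [qn qn1]; have [u eq_u] := ideal_local eX eY qn.
have wn0 : ev Q (w ^+ n) != 0 by rewrite evX expf_neq0.
exists (w ^+ n), u; split=> //; apply: contra_notN qn1 => /eqP u0.
apply: (ideal_unit wn0); rewrite eq_u mulrC.
exact: (ideal_succ u0 (ideal_exp n t0)).
Qed.

Lemma vanishing_order0 Q q : ev Q q != 0 -> vanishing_order Q q 0.
Proof. by move=> q0; split; [apply: ideal0 | move/ideal_ev/eqP; apply/negP]. Qed.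

(** Working with local units on both sides avoids the local rings. *)
Lemma same_order_units Q n p q : vanishing_order Q p n -> vanishing_order Q q n ->
  exists u v, [/\ ev Q u != 0, ev Q v != 0 & u * p = v * q].
Proof.
have [t [w [nzt t0 w0 [a eX] [b eY]]]] := local_parameter Q.
move=> /(vanishing_order_local t0 w0 eX eY)[w1 [u1 [w10 u10 e1]]].
move=> /(vanishing_order_local t0 w0 eX eY)[w2 [u2 [w20 u20 e2]]].
exists (w1 * u2), (w2 * u1); rewrite !evM !mulf_neq0 //; split=> //.
have -> : w1 * u2 * p = u2 * (w1 * p) by ring.
have -> : w2 * u1 * q = u1 * (w2 * q) by ring.
by rewrite e1 e2; ring.
Qed.

Variable P : affine_pt f.
Hypothesis yP_neq0 : (val P).2 != 0.

Lemma order_P q n u w : ev P u != 0 -> ev P w != 0 ->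
  w * q = dX P ^+ n * u -> vanishing_order P q n.
Proof.
have [nzt t0 y0 [b eY]] := dX_parameter yP_neq0.
set wY := coord_Y f + _ in y0 eY; have eX := mulrC wY (dX P).
move=> u0 w0 eq_q; split.
  apply: (ideal_unit w0); rewrite eq_q mulrC.
  exact/ideal_mul/ideal_exp.
move=> qn; have [u' eq_u'] := ideal_local eX eY qn. 
have e : wY ^+ n.+1 * u = dX P * (w * u').
  have nzn : dX P ^+ n != 0.
    elim: n {qn eq_q eq_u'} => [|n IHn]; rewrite ?oner_neq0 // exprS.
    by rewrite (coord_mulf_eq0 f_monic size_f) negb_or nzt.
  apply: (mulfI nzn).
  have -> : dX P ^+ n * (wY ^+ n.+1 * u) = wY ^+ n.+1 * (dX P ^+ n * u) by ring.
  by rewrite -eq_q mulrCA eq_u' exprS; ring.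
have := mulf_neq0 (expf_neq0 n.+1 y0) u0.
by rewrite -evX -evM e evM t0 mul0r eqxx.
Qed.

(** * Principal multiples of [P] - [infinity] *)

Lemma conj_pt_subproof Q : (- (val Q).2) ^+ 2 == f.[(val Q).1].
Proof. by rewrite sqrrN (valP Q). Qed.

Definition conj_pt Q : affine_pt f :=
  exist _ ((val Q).1, - (val Q).2) (conj_pt_subproof Q).

Lemma ev_conj_pt Q q : ev Q (conj q) = ev (conj_pt Q) q.
Proof. exact: ev_conj. Qed.

Lemma ev_norm Q q : (norm q).[(val Q).1] = ev Q q * ev (conj_pt Q) q.
Proof. by rewrite -ev_conj_pt -evM mul_conj ev_poly. Qed.

Lemma point_above xi : exists Q, (val Q).1 = xi.
Proof.
have : size ('X^2 - f.[xi]%:P) != 1%N by rewrite size_XnsubC.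
case/closed_rootP => eta; rewrite /root !hornerE subr_eq0 => /eqP e.
have eq_eta : (xi, eta).2 ^+ 2 == f.[(xi, eta).1] by rewrite /= e.
by exists (exist _ (xi, eta) eq_eta).
Qed.

(** The curve is smooth, hence a function without poles in the affine part lies in
    the coordinate ring. For a denominator H(X) it suffices to remove one linear
    factor X - xi at a time: A + B Y is divisible by X - xi if it vanishes at both
    points above xi or, where these coincide, if it is divisible by X - xi up to a
    local unit. *)
Lemma poly_dvd_local (H : {poly K}) p : H != 0 ->
    (forall Q, exists u v, ev Q u != 0 /\ u * p = v * of_poly f H) ->
  exists q, p = of_poly f H * q.
Proof.
elim: {H}(size H) {-2}H (leqnn (size H)) p => [|n IHn] H le_n p nzH loc.
  by move: nzH; rewrite -size_poly_leq0 le_n.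
have [s1|/closed_rootP[xi Hxi]] := eqVneq (size H) 1%N.
  have /size_poly1P[c nzc ->] : size H == 1%N by apply/eqP.
  exists (of_poly f c^-1%:P * p).
  by rewrite mulrA -of_polyM -polyCM mulfV // of_poly1 mul1r.
have /factor_theorem[H1 defH] := Hxi.
have [Q Qxi] := point_above xi.
have [p1 defp] : exists p1, p = of_poly f ('X - xi%:P) * p1.
  set A := (to_func p).1; set B := (to_func p).2.
  have [A0 B0] : A.[xi] = 0 /\ B.[xi] = 0.
    have vanish Q' : (val Q').1 = xi -> A.[xi] + B.[xi] * (val Q').2 = 0.
      move=> Q'xi; have [u [v [u0 /(congr1 (ev Q'))]]] := loc Q'.
      rewrite !evM ev_poly Q'xi (rootP Hxi) mulr0 => /eqP.
      by rewrite mulf_eq0 (negPf u0) /= /ev Q'xi => /eqP.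
    have e1 := vanish Q Qxi; have e2 := vanish (conj_pt Q) Qxi.
    have [y0|y0] := eqVneq (val Q).2 0; last first.
      have : 2 * B.[xi] * (val Q).2 = 0 by rewrite -[RHS](subrr 0) -{1}e1 -e2 /=; ring.
      move/eqP; rewrite !mulf_eq0 (negPf two_neq0) (negPf y0) orbF => /eqP B0.
      by move: e1; rewrite B0 mul0r addr0.
    (* At a branch point the norm of the local unit u is a unit on the X-line. *)
    have [u [v [u0 eq_u]]] := loc Q.
    have N0 : (norm u).[xi] != 0.
      rewrite -Qxi ev_norm (_ : ev (conj_pt Q) u = ev Q u) ?mulf_neq0 //.
      by rewrite /ev /= y0 oppr0.
    have : of_poly f (norm u) * p = of_poly f ('X - xi%:P) * (conj u * v * of_poly f H1).
      rewrite -mul_conj mulrAC eq_u defH of_polyM.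
      by move: (of_poly f H1) (of_poly f _) (conj u) => h1 x cu; ring.
    move/(congr1 (@to_func K f)); rewrite !to_funcM !of_funcK /fmul /= !(mul0r, addr0).
    case=> /(congr1 (horner^~ xi)) eA /(congr1 (horner^~ xi)) eB.
    move: eA eB; rewrite !hornerM !hornerXsubC !subrr !mul0r => /eqP eA /eqP eB.
    by move: eA eB; rewrite !mulf_eq0 (negPf N0) /= => /eqP ? /eqP ?.
  have /factor_theorem[A1 defA] : root A xi by apply/rootP.
  have /factor_theorem[B1 defB] : root B xi by apply/rootP.
  exists (of_func f (A1, B1)); rewrite -of_funcM -[LHS]to_funcK; congr of_func.
  rewrite /fmul /= !mul0r !addr0 [_ * A1]mulrC [_ * B1]mulrC -defA -defB.
  by rewrite /A /B; case: (to_func p).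
have nzX : of_poly f ('X - xi%:P) != 0.
  rewrite -(norm_eq0 f_monic size_f) /norm of_funcK.
  by rewrite /fnorm /= expr0n mul0r subr0 expf_eq0 /= polyXsubC_eq0.
have nzH1 : H1 != 0 by apply: contraNneq nzH => H10; rewrite defH H10 mul0r.
have [|Q'|q defq] := IHn H1 _ p1 nzH1.
- move: le_n; rewrite defH size_mul ?polyXsubC_eq0 // size_XsubC addnS /=.
  by rewrite addn1 ltnS.
- have [u [v [u0 eq_u]]] := loc Q'; exists u, v; split=> //.
  apply: (mulfI nzX); move: eq_u; rewrite defp defH of_polyM => eq_u.
  by rewrite mulrCA eq_u [of_poly f H1 * _]mulrC mulrCA.
by exists q; rewrite defp defq defH of_polyM mulrCA mulrA.
Qed.

(** The norm of g has no zero outside x_P, and g does not vanish at the conjugate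
    of P: so the divisor of g is r [P] - r [infinity]. *)
Definition torsion_at r : Prop := exists2 g : func K,
  (exists2 c, c != 0 & fnorm f g = c *: ('X - (val P).1%:P) ^+ r)
  & ev (conj_pt P) (of_func f g) != 0.

Lemma order_P_unique m n u v : ev P u != 0 -> ev P v != 0 ->
  dX P ^+ m * u = dX P ^+ n * v -> m = n.
Proof.
have nzd k : dX P ^+ k != 0.
  elim: k => [|k IHk]; rewrite ?oner_neq0 // exprS.
  by rewrite (coord_mulf_eq0 f_monic size_f) negb_or dX_neq0.
have lt_absurd k l a b :
    (k < l)%N -> ev P a != 0 -> dX P ^+ k * a = dX P ^+ l * b -> False.
  move=> lt_kl a0; rewrite -(subnKC (ltnW lt_kl)) exprD -mulrA => /(mulfI (nzd k)) e.
  case/eqP: a0; rewrite e evM evX ev_dX expr0n.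
  by rewrite (_ : (l - k == 0)%N = false) ?mul0r //; lia.
move=> u0 v0 e; case: (ltngtP m n) => // lt.
  by case: (lt_absurd _ _ _ _ lt u0 e).
by case: (lt_absurd _ _ _ _ lt v0 (esym e)).
Qed.

(** If p / q has the divisor r [P] - r [infinity], then it is regular on the
    affine curve, so q divides p. *)
Lemma torsion_at_of_quotient r p q : p != 0 -> q != 0 ->
    (forall Q, Q != P -> exists u v, [/\ ev Q u != 0, ev Q v != 0 & u * p = v * q]) ->
    (exists u v, [/\ ev P u != 0, ev P v != 0 & u * p = v * (dX P ^+ r * q)]) ->
  torsion_at r.
Proof.
move=> nzp nzq units [uP [vP [uP0 vP0 eq_P]]].
have [|Q|G defG] := @poly_dvd_local (norm q) (p * conj q).
- by rewrite norm_eq0.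
- have [->|/units[u [v [u0 v0 e]]]] := eqVneq Q P.
    exists uP, (vP * dX P ^+ r); split=> //.
    by rewrite mulrA eq_P -mul_conj; ring.
  by exists u, v; split=> //; rewrite mulrA e -mul_conj; ring.
have {}defG : p = q * G.
  have nzc : conj q != 0 by rewrite conj_eq0.
  by apply: (mulfI nzc); rewrite mulrC defG -mul_conj; ring.
have G_neq0 Q : Q != P -> ev Q G != 0.
  move=> /units[u [v [u0 v0 e]]]; apply: contraNneq v0 => G0.
  have : u * G = v by apply: (mulfI nzq); rewrite mulrCA -defG e mulrC.
  by move=> <-; rewrite evM G0 mulr0.
have eqG : uP * G = dX P ^+ r * vP.
  by apply: (mulfI nzq); rewrite mulrCA -defG eq_P; ring.
have P'P : conj_pt P != P.
  apply/negP => /eqP e.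
  have /eqP : - (val P).2 = (val P).2 := congr1 (fun Q => (val Q).2) e.
  rewrite -subr_eq0 -opprD oppr_eq0 -mulr2n -mulr_natl mulf_eq0.
  by rewrite (negPf two_neq0) (negPf yP_neq0).
have nzG : G != 0 by apply: contraNneq nzp => G0; rewrite defG G0 mulr0.
have [rs defN] := closed_field_poly_normal (norm G).
have nzN : norm G != 0 by rewrite norm_eq0.
have nzl : lead_coef (norm G) != 0 by rewrite lead_coef_eq0.
have all_x z : z \in rs -> z = (val P).1.
  move=> z_rs; have [Q Qz] := point_above z.
  have : (norm G).[(val Q).1] = 0.
    by apply/rootP; rewrite defN rootZ // root_prod_XsubC Qz.
  move/eqP; rewrite ev_norm mulf_eq0 => /orP[] Q0.
    by rewrite -Qz; case: (eqVneq Q P) Q0 => [->//|/G_neq0/negPf->].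
  rewrite -Qz -[(val Q).1]/((val (conj_pt Q)).1).
  by case: (eqVneq (conj_pt Q) P) Q0 => [->//|/G_neq0/negPf->].
have {}defN : norm G = lead_coef (norm G) *: ('X - (val P).1%:P) ^+ size rs.
  rewrite [LHS]defN (eq_big_seq (fun=> 'X - (val P).1%:P)) => [|z /all_x->//].
  by rewrite big_const_seq count_predT iter_mulr_1.
have def_r : size rs = r.
  pose c := of_poly f (lead_coef (norm G))%:P.
  apply: (@order_P_unique _ _ (uP * c) (conj G * vP)).
  - by rewrite evM ev_poly hornerC mulf_neq0.
  - by rewrite evM ev_conj_pt mulf_neq0 // G_neq0.
  have -> : dX P ^+ size rs * (uP * c) = uP * of_poly f (norm G).
    by rewrite defN -mul_polyC of_polyM of_polyX -dX_E /c; ring.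
  by rewrite -mul_conj mulrA eqG; ring.
exists (to_func G); last by rewrite to_funcK G_neq0.
by exists (lead_coef (norm G)); rewrite // -def_r.
Qed.

Lemma coeff_point_divisor r Q :
  coeff (Some Q) (point_divisor P *+ r) = (if Q == P then r else 0%N)%:Z.
Proof.
rewrite coeffMn coeffB !coeffU mul1r subr0 eq_sym -mulrnA natz.
by rewrite -[Some Q == Some P]/(Q == P); case: eqP => _; rewrite ?mul0n ?mul1n.
Qed.

Lemma coeff_infinity_point_divisor r :
  coeff None (point_divisor P *+ r) = - r%:Z.
Proof. by rewrite coeffMn coeffB !coeffU /= mulr0 mul1r sub0r mulNrn natz. Qed.

Lemma torsion_at_of_principal r : principal (point_divisor P *+ r) -> torsion_at r.
Proof.
case=> p [q [Dp [Dq [nzp nzq [divp _] [divq _] eqD]]]].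
have orders Q : exists m, vanishing_order Q q m /\
    vanishing_order Q p (m + (if Q == P then r else 0))%N.
  have [n pn en] := divp Q; have [m qm em] := divq Q; exists m; split=> //.
  have := coeff_point_divisor r Q; rewrite eqD coeffB en em.
  by move=> e; rewrite (_ : (m + _)%N = n) //; move: e; case: ifP; lia.
apply: (@torsion_at_of_quotient r p q) => // [Q QP|].
  have [m [qm]] := orders Q; rewrite (negPf QP) addn0 => pm.
  exact: same_order_units pm qm.
have [m [qm]] := orders P; rewrite eqxx => pm.
have [_ t0 w0 [b eY]] := dX_parameter yP_neq0.
set w := coord_Y f + _ in w0 eY; have eX := mulrC w (dX P).
have [w1 [u1 [w10 u10 e1]]] := vanishing_order_local t0 w0 eX eY pm.
have [w2 [u2 [w20 u20 e2]]] := vanishing_order_local t0 w0 eX eY qm.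
exists (w1 * u2), (w2 * u1); rewrite !evM !mulf_neq0 //; split=> //.
have -> : w1 * u2 * p = u2 * (w1 * p) by ring.
have -> : w2 * u1 * (dX P ^+ r * q) = u1 * dX P ^+ r * (w2 * q) by ring.
by rewrite e1 e2 exprD; ring.
Qed.

Lemma pole_order_norm p : pole_order p = (size (norm p)).-1.
Proof.
rewrite /pole_order /norm /to_func.
move: (_`_0) (_`_1) => a b; rewrite size_f /fnorm /=.
have size_sqr (z : {poly K}) : (size (z ^+ 2)).-1 = ((size z).-1 * 2)%N := size_exp z 2.
have [->|nzb] := eqVneq b 0.
  by rewrite expr0n mul0r subr0 maxn0 size_sqr mulnC.
have sB : size (- (b ^+ 2 * f)) = ((size b).-1 * 2 + 6)%N.
  have nzf : f != 0 by rewrite -size_poly_eq0 size_f.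
  rewrite size_polyN size_mul ?expf_neq0 // size_f.
  have := size_sqr b; have : (0 < size (b ^+ 2))%N by rewrite size_poly_gt0 expf_neq0.
  by move: (size (b ^+ 2)) => m; lia.
have [->|nza] := eqVneq a 0.
  rewrite expr0n /= add0r sB size_poly0 muln0 max0n.
  by move: (size b).-1 => m; lia.
have sA : size (a ^+ 2) = ((size a).-1 * 2).+1.
  have := size_sqr a; have : (0 < size (a ^+ 2))%N by rewrite size_poly_gt0 expf_neq0.
  by move: (size (a ^+ 2)) => m; lia.
have [lt_AB|le_BA] := ltnP (size (a ^+ 2)) (size (- (b ^+ 2 * f))).
  rewrite addrC size_polyDl // sB; move: lt_AB; rewrite sA sB.
  by move: (size a).-1 (size b).-1 => m n; lia.
rewrite size_polyDl sA; move: le_BA; rewrite sA sB;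
  by move: (size a).-1 (size b).-1 => m n; lia.
Qed.

Lemma torsion_ev_neq0 r g c Q : c != 0 ->
    fnorm f g = c *: ('X - (val P).1%:P) ^+ r ->
    ev (conj_pt P) (of_func f g) != 0 -> Q != P -> ev Q (of_func f g) != 0.
Proof.
move=> nzc normE evP' QP; apply/negP => /eqP evQ.
have xQ : (val Q).1 = (val P).1.
  have := ev_norm Q (of_func f g); rewrite evQ mul0r /norm of_funcK normE.
  rewrite hornerZ horner_exp hornerXsubC => /eqP.
  by rewrite mulf_eq0 (negPf nzc) expf_eq0 subr_eq0 => /andP[_ /eqP].
have /eqP := eqP (valP Q); rewrite xQ -(eqP (valP P)) eqf_sqr => /orP[] /eqP yQ.
  by case/negP: QP; apply/eqP/val_inj; case: (val Q) (val P) xQ yQ => ? ? [? ?] /= -> ->.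
case/negP: evP'; rewrite -evQ; apply/eqP; congr (ev _ _); apply/val_inj => /=.
by rewrite -yQ -xQ -surjective_pairing.
Qed.

Lemma principal_of_torsion_at r : torsion_at r -> principal (point_divisor P *+ r).
Proof.
case=> g [c nzc normE] evP'.
have units Q : Q != P -> ev Q (of_func f g) != 0 by apply: torsion_ev_neq0 normE evP'.
have norm1 : norm (1 : R) = 1.
  by rewrite -(of_poly1 f) /norm of_funcK /fnorm /= expr0n mul0r subr0 expr1n.
exists (of_func f g), 1, (point_divisor P *+ r), 0; split; rewrite ?subr0 ?oner_neq0 //.
- rewrite -(norm_eq0 f_monic size_f) /norm of_funcK normE scaler_eq0 (negPf nzc).
  by rewrite expf_eq0 polyXsubC_eq0 andbF.
- split=> [Q|]; last first.
    rewrite coeff_infinity_point_divisor pole_order_norm /norm of_funcK normE.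
    by rewrite size_scale // size_exp_XsubC.
  exists (if Q == P then r else 0%N); last exact: coeff_point_divisor.
  case: eqVneq => [->|QP]; last exact/vanishing_order0/units.
  apply: (@order_P _ _ (of_poly f c%:P) (conj (of_func f g))).
  + by rewrite ev_poly hornerC.
  + by rewrite ev_conj_pt.
  rewrite mulrC mul_conj /norm of_funcK normE -mul_polyC of_polyM of_polyX.
  by rewrite dX_E mulrC.
split=> [Q|]; last by rewrite coeff0 pole_order_norm norm1 size_poly1.
by exists 0%N; rewrite ?coeff0 //; apply: vanishing_order0; rewrite ev1 oner_neq0.
Qed.

Lemma torsion_at_sub m n : torsion_at (m + n) -> torsion_at m -> torsion_at n.
Proof.
case=> [g [c nzc normg] evg] [h [e nze normh] evh].
have nz k (u : func K) a : a != 0 ->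
    fnorm f u = a *: ('X - (val P).1%:P) ^+ k -> of_func f u != 0.
  move=> nza normu; rewrite -(norm_eq0 f_monic size_f) /norm of_funcK normu.
  by rewrite scaler_eq0 (negPf nza) expf_eq0 polyXsubC_eq0 andbF.
have conjE k (u : func K) a : fnorm f u = a *: ('X - (val P).1%:P) ^+ k ->
    of_func f u * conj (of_func f u) = of_poly f a%:P * dX P ^+ k.
  move=> normu; rewrite mul_conj /norm of_funcK normu -mul_polyC of_polyM of_polyX.
  by rewrite dX_E.
apply: (@torsion_at_of_quotient n (of_func f g) (of_func f h)).
- exact: nz normg.
- exact: nz normh.
- move=> Q QP; exists (of_func f h), (of_func f g).
  by split; [apply: torsion_ev_neq0 normh evh QP
            | apply: torsion_ev_neq0 normg evg QP | rewrite mulrC].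
have := conjE _ _ _ normh; have := conjE _ _ _ normg.
rewrite -ev_conj_pt in evg; rewrite -ev_conj_pt in evh.
have evC a : a != 0 -> ev P (of_poly f a%:P) != 0 by rewrite ev_poly hornerC.
move: evg evh (evC _ nzc) (evC _ nze) {conjE}.
move: (of_func f g) (of_func f h) (of_poly f c%:P) (of_poly f e%:P)
  (conj (of_func f g)) (conj (of_func f h)) (dX P).
move=> p q cc ce p' q' t p'0 q'0 cc0 ce0 eqp eqq.
exists (ce * p'), (cc * q'); split; [by rewrite evM mulf_neq0.. |].
have -> : ce * p' * p = ce * (p * p') by ring.
have -> : cc * q' * (t ^+ n * q) = cc * t ^+ n * (q * q') by ring.
by rewrite eqp eqq exprD; ring.
Qed.

Lemma class_order_dvdn r t : class_order (point_divisor P) r -> torsion_at t ->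
  (r %| t)%N.
Proof.
case=> r_gt0 /torsion_at_of_principal tors_r min_r.
elim/ltn_ind: t => -[|t] IHt tors_t; first exact: dvdn0.
have le_rt : (r <= t.+1)%N by apply: min_r => //; apply: principal_of_torsion_at.
rewrite -(subnKC le_rt) dvdn_addr //; apply: IHt; first by lia.
by apply: (torsion_at_sub _ tors_r); rewrite subnKC.
Qed.

(* The point is moved to the line X = 0, where X is the local parameter. *)
Let x : K := (val P).1.
Let fx : {poly K} := f \Po ('X + x%:P).

Lemma torsion_function_of_torsion_at (s : nat -> K) r : s 0%N = (val P).2 ->
  torsion_at r -> exists g, torsion_function fx s r g.
Proof.
move=> s0 [g [c nzc normg] evg]; pose T (a : {poly K}) := a \Po ('X + x%:P).
have normE : fnorm fx (T g.1, T g.2) = c *: 'X^r.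
  have -> : fnorm fx (T g.1, T g.2) = T (fnorm f g).
    by rewrite /T /fnorm /fx /= comp_polyB !expr2 !comp_polyM.
  have TX n a : T (a ^+ n) = T a ^+ n.
    elim: n => [|n IHn]; first by rewrite /T comp_polyC.
    by rewrite !exprS -IHn /T comp_polyM.
  rewrite normg [LHS]comp_polyZ [_ ^+ r \Po _]TX; congr (_ *: _ ^+ r).
  by rewrite /T comp_polyB comp_polyX comp_polyC addrK.
have T0 a : (T a)`_0 = a.[x].
  by rewrite -horner_coef0 horner_comp !hornerE.
exists (T g.1, T g.2); split.
- by rewrite normE coefZ coefXn eqxx mulr1.
- by rewrite normE scaler_eq0 (negPf nzc) -size_poly_eq0 size_polyXn.
by rewrite /= !T0 s0 -mulrN; move: evg; rewrite /ev of_funcK.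
Qed.

Lemma torsion_at_of_torsion_function (s : nat -> K) r g : s 0%N = (val P).2 ->
  torsion_function fx s r g -> torsion_at r.
Proof.
move=> s0 [normg nzn evg]; pose T (a : {poly K}) := a \Po ('X - x%:P).
have Tfx : T fx = f.
  rewrite /T /fx -comp_polyA comp_polyD comp_polyX comp_polyC subrK.
  exact: comp_polyXr.
exists (T g.1, T g.2).
  exists (fnorm fx g)`_r.
    by apply: contraNneq nzn => c0; rewrite normg c0 scale0r.
  have -> : fnorm f (T g.1, T g.2) = T (fnorm fx g).
    by rewrite -{1}Tfx /T /fnorm /= comp_polyB !expr2 !comp_polyM.
  by rewrite normg /T comp_polyZ comp_Xn_poly coefZ coefXn eqxx mulr1.
rewrite /ev of_funcK /T /= !horner_comp !hornerE -/x subrr !horner_coef0 mulrN -s0.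
exact: evg.
Qed.

End Principal.
(** * Reduction modulo p *)

Section Reduction.
Variables (R S : comNzRingType) (h : {rmorphism R -> S}).
Implicit Type F : {poly R}.

Lemma map_shift_poly F :
  map_poly (map_poly h) (shift_poly F) = shift_poly (map_poly h F).
Proof.
rewrite /shift_poly map_comp_poly rmorphB /= map_polyX map_polyC /= map_polyX.
congr (_ \Po _); rewrite -!map_poly_comp; apply: eq_map_poly => a /=.
by rewrite map_polyC.
Qed.

Lemma map_cantor_P F j : map_poly h (cantor_P F j) = cantor_P (map_poly h F) j.
Proof.
elim/ltn_ind: j => -[|j] IHj; first by rewrite /cantor_P /= rmorph0.
rewrite !cantor_P_rec rmorphB rmorph_sum rmorphM rmorphXn /= map_polyZ rmorph_nat.
congr (_ - _ * _); last by rewrite -map_shift_poly coef_map.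
by apply: eq_big_nat => i le_i; rewrite rmorphM /= !IHj //; lia.
Qed.

Lemma map_psi_nat F n : map_poly h (psi_nat F n) = psi_nat (map_poly h F) n.
Proof.
have map_det N k : map_poly h (\det (\matrix_(i < N, j < N) cantor_P F (k + i + j)))
    = \det (\matrix_(i < N, j < N) cantor_P (map_poly h F) (k + i + j)).
  rewrite -det_map_mx; congr (\det _); apply/matrixP => i j.
  by rewrite !mxE; apply: map_cantor_P.
case: n => [|[|m]]; rewrite ?rmorph0 //= /psi_nat.
case: ifP => _; last exact: map_det.
by rewrite rmorphM /= map_polyZ rmorph_nat map_det.
Qed.

Lemma map_psi F n : map_poly h (psi F n) = psi (map_poly h F) n.
Proof.
case: n => n; first exact: map_psi_nat.
by rewrite -[RHS]/(- psi_nat (map_poly h F) n.+1) -map_psi_nat -rmorphN.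
Qed.

End Reduction.

Lemma psiN (R : comNzRingType) (F : {poly R}) n : psi F (- n) = - psi F n.
Proof. by case: n => [[|n]|n] //=; rewrite ?oppr0 // opprK. Qed.

(** * The period *)

Section Period.
Variables (K : closedFieldType) (f : {poly K}).
Hypotheses (f_monic : f \is monic) (size_f : size f = 6%N).
Hypothesis two_neq0 : (2 : K) != 0.
Hypothesis f_sep : forall xi, f.[xi] = 0 -> f^`().[xi] != 0.
Variable P : affine_pt f.
Hypothesis yP_neq0 : (val P).2 != 0.

Let x : K := (val P).1.
Let y : K := (val P).2.
Let c (n : int) : K := (psi f n).[x].
Let fx : {poly K} := f \Po ('X + x%:P).
Let s := Y_series f x y.

Let fx_monic : fx \is monic.
Proof.
rewrite monicE /fx lead_coef_comp ?size_XaddC // lead_coefXaddC expr1n mulr1.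
by rewrite -monicE.
Qed.

Let size_fx : size fx = 6%N.
Proof. by rewrite /fx size_comp_poly2 ?size_XaddC. Qed.

Let yE : y ^+ 2 = f.[x]. Proof. exact/eqP/(valP P). Qed.
Let s_sqr := Y_series_sqr two_neq0 yP_neq0 yE.

Let cN n : c (- n) = - c n. Proof. by rewrite /c psiN hornerN. Qed.
Let c0 : c 0 = 0. Proof. by rewrite /c /= horner0. Qed.
Let c1 : c 1 = 0. Proof. by rewrite /c /= horner0. Qed.
Let c_tau (n : nat) : (2 <= n)%N -> c n * (2 * y) = (2 * y) ^+ 'C(n, 2) * tau s n.
Proof. exact: psi_tau. Qed.

Lemma psi2_eval : c 2 = 1.
Proof. by rewrite /c /= det_mx00 hornerC. Qed.

Lemma psi3_eval : c 3 = 4 * f.[x].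
Proof. by rewrite /c /= det_mx00 mulr1 hornerZ. Qed.

Lemma psi_quasi_periodic r : class_order (point_divisor P) r ->
  exists A B, [/\ A != 0, B != 0, A ^+ r = B ^+ 2
    & forall n : int, c (n + r%:Z) = A ^ n * B * c n].
Proof.
move=> [r_gt0 /(torsion_at_of_principal f_monic size_f two_neq0 f_sep yP_neq0) tors _].
have [g torsg] := @torsion_function_of_torsion_at K f P s r (erefl _) tors.
exact: (c_quasi_periodic fx_monic size_fx s_sqr yP_neq0 two_neq0 (erefl _)
          cN c0 c1 c_tau r_gt0 torsg).
Qed.

(** If t is a period, then c vanishes at t - 1 and t + 1, as it does at - 1 and
    1. *)
Lemma psi_period_dvd r t : class_order (point_divisor P) r -> (0 < t)%N ->
  (forall n : int, c (n + t%:Z) = c n) -> (r %| t)%N.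
Proof.
move=> ord_r t_gt0 per_t.
have ct1 : c t.+1 = 0 by rewrite -c1 -(per_t 1); congr c; lia.
have t_ge3 : (3 <= t)%N.
  case: t t_gt0 per_t ct1 => [|[|[|t]]] // _ _.
    by rewrite psi2_eval => /eqP; rewrite oner_eq0.
  move/eqP; rewrite psi3_eval -yE mulf_eq0 expf_eq0 /= (negPf yP_neq0) orbF.
  by rewrite (natrM _ 2 2) mulf_eq0 (negPf two_neq0).
have ct0 : c t.-1 = 0.
  have -> : c t.-1 = c (- 1) by rewrite -(per_t (- 1)); congr c; lia.
  by rewrite cN c1 oppr0.
have tau0 n : (2 <= n)%N -> c n = 0 -> tau s n = 0.
  by move=> n_ge2 /eqP; rewrite (c_eq0 (s := s) yP_neq0 two_neq0 (erefl _) c_tau) // => /eqP.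
have [||g torsg] := torsion_of_tau_eq0 fx_monic size_fx s_sqr yP_neq0 two_neq0 t_ge3.
- by apply: tau0; first by lia.
- by apply: tau0; first by lia.
apply: (class_order_dvdn f_monic size_f two_neq0 f_sep yP_neq0 ord_r).
exact: (@torsion_at_of_torsion_function K f P s t g).
Qed.

End Period.

(** The discriminant is up to sign the resultant, a combination of F and its
    derivative with integral coefficients. This is valid after reduction even if p
    divides the leading coefficient of the derivative. *)
Lemma discr_separable (F : {poly int}) (p : nat) (K : fieldType)
    (h : {rmorphism 'F_p -> K}) : prime p -> F \is monic -> size F = 6%N ->
    ~~ (p %| discr F)%Z -> let f := map_poly h (map_poly (red_mod p) F) in
  forall xi, f.[xi] = 0 -> f^`().[xi] != 0.
Proof.
move=> p_pr F_monic size_F ndvd f xi f0; apply: contraNneq ndvd => f'0.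
have size_F' : (1 < size F^`())%N.
  have lead : (F^`())`_4 != 0.
    rewrite coef_deriv.
    by move: F_monic; rewrite monicE lead_coefE size_F => /eqP ->.
  rewrite ltnNge; apply: contraNN lead => le1.
  by rewrite nth_default //; apply: leq_trans le1 _.
have [|uv _ res] := @resultant_in_ideal _ F F^`() _ size_F'; first by rewrite size_F.
rewrite /discr dvdzE abszMsign -dvdzE (dvdz_pcharf (pchar_Fp p_pr)).
rewrite -(fmorph_eq0 h); apply/eqP.
pose H a := (map_poly h (map_poly (red_mod p) a)).[xi].
have : H (resultant F F^`())%:P = 0.
  have HM a b : H (a * b) = H a * H b by rewrite /H !rmorphM hornerM.
  have HD a b : H (a + b) = H a + H b by rewrite /H !rmorphD hornerD.
  have HF : H F = 0 by [].
  have HF' : H F^`() = 0 by rewrite /H -!deriv_map.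
  by rewrite res HD !HM HF HF' !mulr0 addr0.
by rewrite /H !map_polyC /= hornerC.
Qed.

Theorem theorem1p3 (a0 a1 a2 a3 a4 : int) :
  let F : {poly int} :=
    'X^5 + a4 *: 'X^4 + a3 *: 'X^3 + a2 *: 'X^2 + a1 *: 'X + a0%:P in
  discr F != 0 ->
  forall P : affine_pt F,
  let c (n : int) : int := (psi F n).[(val P).1] in
  let delta := c 3 * c 4 * c 5 * c 6 * c 7 * (c 4 ^+ 3 - c 3 ^+ 3 * c 5) in
  delta != 0 ->
  forall p : nat, prime p -> odd p ->
  ~~ (p %| discr F)%Z -> ~~ (p %| delta)%Z ->
  forall (K : closedFieldType) (iota : {rmorphism 'F_p -> K}),
  integralRange iota ->
  let Pbar := affine_map iota (affine_map (red_mod p) P) in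
  forall r : nat, class_order (point_divisor Pbar) r ->
  let cp (n : int) : 'F_p := (c n)%:~R in
  let alpha := cp (r + 3)%N / (cp 3 * cp (r + 2)%N) in
  let beta := cp 3 ^+ 2 * cp (r + 2)%N ^+ 3 / cp (r + 3)%N ^+ 2 in
  [/\ cp (r + 2)%N != 0, cp (r + 3)%N != 0
    & forall d : nat,
        least_pos (fun e => alpha ^+ e = 1 /\ beta ^+ (e ^ 2) = 1) d ->
        is_period cp (d * r)].
Proof.
move=> F _ P c delta _ p p_pr p_odd ndvd_disc ndvd_delta K iota _ Pbar r ord_r.
move=> cp alpha beta.
have size_F : size F = 6%N.
  rewrite /F -!addrA size_polyDl size_polyXn // ltnS.
  by apply/leq_sizeP => j le_j; rewrite !coefE !gtn_eqF ?mulr0 ?addr0 //;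
    apply: leq_trans le_j.
have F_monic : F \is monic.
  by rewrite monicE lead_coefE size_F /F !coefE /= !mulr0 !addr0.
pose f := map_poly iota (map_poly (red_mod p) F).
have f_monic : f \is monic by rewrite !monic_map.
have size_f : size f = 6%N.
  have size_map (R : nzRingType) (L : fieldType) (h : {rmorphism R -> L}) (a : {poly R}) :
      a \is monic -> size (map_poly h a) = size a.
    by move=> /monicP a1'; rewrite size_map_poly_id0 // a1' rmorph1 oner_neq0.
  by rewrite /f !size_map ?size_F ?monic_map.
have f_sep := discr_separable (h := iota) p_pr F_monic size_F ndvd_disc.
have two_neq0 : (2 : K) != 0.
  rewrite -(rmorph_nat iota) fmorph_eq0 -(dvdn_pcharf (pchar_Fp p_pr)).
  by apply: contraL p_odd; rewrite dvdn_prime2 // => /eqP ->.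
pose C n := (psi f n).[(val Pbar).1].
have CE n : iota (cp n) = C n.
  by rewrite /C /f -!map_psi !horner_map.
have cp3 : cp 3 != 0.
  rewrite -(dvdz_pcharf (pchar_Fp p_pr)); apply: contraNN ndvd_delta => dvd3.
  by rewrite /delta -!mulrA dvdz_mulr.
have C3 : C 3 != 0 by rewrite -CE fmorph_eq0.
have C2 : C 2 = 1 by apply: psi2_eval.
have yP_neq0 : (val Pbar).2 != 0.
  apply: contraNneq C3 => y0; rewrite /C psi3_eval.
  by rewrite -(eqP (valP Pbar)) y0 expr0n mulr0.
have [A [B [A0 B0 AB shift]]] :=
  psi_quasi_periodic f_monic size_f two_neq0 f_sep yP_neq0 ord_r.
have {}shift n : C (n + r%:Z) = A ^ n * B * C n := shift n.
have period_dvd t : (0 < t)%N -> (forall n, C (n + t%:Z) = C n) -> (r %| t)%N.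
  exact: (psi_period_dvd f_monic size_f two_neq0 f_sep yP_neq0 ord_r).
clearbody C.
have Cr2 : C (r + 2)%N = A ^+ 2 * B.
  by rewrite addnC PoszD shift C2 mulr1.
have Cr3 : C (r + 3)%N = A ^+ 3 * B * C 3.
  by rewrite addnC PoszD shift.
have Cr2_neq0 : C (r + 2)%N != 0 by rewrite Cr2 mulf_neq0 ?expf_neq0.
have Cr3_neq0 : C (r + 3)%N != 0 by rewrite Cr3 !mulf_neq0 ?expf_neq0.
have alphaE : iota alpha = A.
  rewrite /alpha fmorph_div rmorphM !CE Cr2 Cr3; field.
  by rewrite C3 A0 B0.
have betaE : iota beta = B.
  rewrite /beta fmorph_div rmorphM !rmorphXn /= !CE Cr2 Cr3; field.
  by rewrite C3 A0 B0.
split=> [||d].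
- by rewrite -(fmorph_eq0 iota) CE.
- by rewrite -(fmorph_eq0 iota) CE.
have eq1 a e : (iota a ^+ e = 1) <-> (a ^+ e = 1).
  by rewrite -rmorphXn -(rmorph1 iota); split=> [/fmorph_inj//|->].
have period_iff t : (forall n, cp (n + t%:Z) = cp n) <-> (forall n, C (n + t%:Z) = C n).
  by split=> per n; [rewrite -!CE per | apply: (fmorph_inj iota); rewrite !CE].
have r_gt0 : (0 < r)%N by case: ord_r.
move=> [d_gt0 [ad bd] min_d].
have [|||dr_gt0 per_dr min_dr] :=
  @quasi_period_is_period K C A B r A0 B0 AB shift _ C3 d r_gt0.
- by rewrite C2 oner_neq0.
- exact: period_dvd.
- split=> //; first by rewrite -alphaE -betaE !eq1.
  by move=> m m_gt0; rewrite -alphaE -betaE !eq1; apply: min_d.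
split=> //; first exact/period_iff.
by move=> m m_gt0 /period_iff; apply: min_dr.
Qed.
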